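(* Suppose that $\gamma(\mathbf{x},\mathbf{y})=\tilde\gamma(|\mathbf{y}-\mathbf{x}|)$ satisfies the kernel assumptions (K1) and (K2) stated in the context and $b\in C(\Omega)$. Let $u$ be the solution of $$-\mathcal{L}u=b\ \text{ on }\Omega,\qquad u=0\ \text{ on }\Omega_I,$$ and let $u_h\in V^{pc,h}_{c,0}$ be the solution of the discrete problem $$-\int_{\Omega_h}\mathcal{L}u_h(\mathbf{x})\,w_h(\mathbf{x})\,d\mathbf{x}=\int_{\Omega_h}b(\mathbf{x})w_h(\mathbf{x})\,d\mathbf{x}\qquad\forall w_h\in V^{pc,h}_{c,0}.$$ Define $\tilde u(\mathbf{x},\Omega_h)=u(\mathbf{x})$ for $\mathbf{x}\in\Omega_h$ and $\tilde u(\mathbf{x},\Omega_h)=0$ for $\mathbf{x}\in(\Omega\cup\Omega_I)\setminus\Omega_h$. Then $$|||\tilde u-u_h|||\le\inf_{w_h\in V^{pc,h}_{c,0}}|||\tilde u-w_h|||.$$ Consequently, there is a constant $C$ independent of $h$ such that $$\|u-u_h\|_{\Omega_h}\le C\min_{w_h\in V^{pc,h}_{c,0}}\|u-w_h\|_{\Omega_h}\to0\quad\text{as }h\to0.$$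
   Context: $\Omega\subset\mathbb{R}^d$ is a bounded, open, convex domain with Lipschitz boundary, $\delta>0$ is a constant (the horizon), and $\Omega_I=\{\mathbf{y}\in\mathbb{R}^d\setminus\Omega:\ \mathrm{dist}(\mathbf{y},\partial\Omega)<\delta\}$. For $\mathbf{x}\in\Omega\cup\Omega_I$ and $r>0$, $B_r(\mathbf{x})=\{\mathbf{y}\in\Omega\cup\Omega_I:\ |\mathbf{y}-\mathbf{x}|\le r\}$. The nonlocal operator is $\mathcal{L}u(\mathbf{x})=\int_{\mathbb{R}^d}(u(\mathbf{y})-u(\mathbf{x}))\gamma(\mathbf{x},\mathbf{y})\,d\mathbf{y}$. Kernel assumptions on the nonnegative symmetric kernel $\gamma$: (K1) there is a constant $\gamma_0>0$ such that for all $\mathbf{x}\in\Omega\cup\Omega_I$: $\gamma(\mathbf{x},\mathbf{y})\ge\gamma_0$ for all $\mathbf{y}\in B_{\delta/2}(\mathbf{x})$, and $\gamma(\mathbf{x},\mathbf{y})=0$ for all $\mathbf{y}\in(\Omega\cup\Omega_I)\setminus B_\delta(\mathbf{x})$; (K2) $\gamma(\mathbf{x},\mathbf{y})=\tilde\gamma(|\mathbf{y}-\mathbf{x}|)\ge0$ and $\int_{\mathbb{R}^d}\tilde\gamma(|\mathbf{z}|)\,d\mathbf{z}=1$. Interactions are limited to distance $\delta$: $\tilde\gamma(r)=0$ for $r>\delta$. Standing assumption: $b\in L^2(\Omega)$. The solution is the function $u\in L^2(\Omega\cup\Omega_I)$ with $u=0$ a.e. on $\Omega_I$ and $-\mathcal{L}u=b$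 a.e. in $\Omega$. Energy norm: $|||v|||=\Big(\int_{\Omega\cup\Omega_I}\int_{\Omega\cup\Omega_I}(v(\mathbf{y})-v(\mathbf{x}))^2\gamma(\mathbf{x},\mathbf{y})\,d\mathbf{y}\,d\mathbf{x}\Big)^{1/2}$. $\|\cdot\|_{D}$ denotes the $L^2(D)$ norm. Discretization: $\mathcal{T}_h$ is a member of a shape-regular, quasi-uniform family (as $h\to0$) of triangulations of $\Omega\cup\Omega_I$ that simultaneously triangulate $\Omega$, $h$ being the largest element diameter; $\Omega_h=\mathcal{T}_h\cap\overline\Omega$ is the union of the elements triangulating $\Omega$ (contained in $\overline\Omega$ since $\Omega$ is convex). Let $\phi_1,\dots,\phi_{m}$ and $\phi_{m+1},\dots,\phi_{m+n}$ be the continuous piecewise linear nodal basis functions on $\mathcal{T}_h$ associated with the nodes in $\Omega_h\setminus\partial\Omega$ and in $\Omega_h\cap\partial\Omega$, respectively. Put $\widehat\phi_j=\phi_j$ on $\Omega_h$ and $\widehat\phi_j=0$ on $(\Omega\cup\Omega_I)\setminus\Omega_h$. $V^{pc,h}_{c,0}$ is the span of $\widehat\phi_1,\dots,\widehat\phi_{m+n}$, i.e. the functions that are continuous piecewise linear on $\Omega_h$ and zero outside $\Omega_h$ (no condition on $\partial\Omega_h$).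
   Formalization: The elements forming Ω_h are required to cover the closure of Ω (so Ω is a polytope); if Ω_h misses a part of Ω of positive measure, the claim fails for u = 1 on Ω, u = 0 on Ω_I, with b = -Lu. *)

(* Defs.v *)
From HB Require Import structures.
From mathcomp Require Import all_boot all_order all_algebra finmap.
From mathcomp Require Import all_classical all_reals all_analysis.

Set Implicit Arguments.
Unset Strict Implicit.
Unset Printing Implicit Defensive.

Import Order.TTheory GRing.Theory Num.Theory.
Import numFieldNormedType.Exports.

Local Open Scope classical_set_scope.
Local Open Scope ring_scope.

(* Product sigma-algebra on row vectors (it is the Borel one). *)
Section measurable_rV.
Context {R : realType} (n : nat).

Let coord (i : 'I_n) (x : 'rV[R]_n) : measurableTypeR R := x ord0 i.

Let rV_set0 : g_sigma_preimage coord set0.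
Proof. exact: sigma_algebra0. Qed.

Let rV_setC A : g_sigma_preimage coord A -> g_sigma_preimage coord (~` A).
Proof. exact: sigma_algebraC. Qed.

Let rV_bigcup (F : _^nat) : (forall i, g_sigma_preimage coord (F i)) ->
  g_sigma_preimage coord (\bigcup_i (F i)).
Proof. exact: sigma_algebra_bigcup. Qed.

HB.instance Definition _ := @isMeasurable.Build default_measure_display
  'rV[R]_n (g_sigma_preimage coord) rV_set0 rV_setC rV_bigcup.

Lemma measurable_coord (i : 'I_n) :
  measurable_fun [set: 'rV[R]_n] (fun x : 'rV[R]_n => x ord0 i : R).
Proof.
move=> _ Y mY; rewrite setTI; apply: sub_sigma_algebra => /=.
rewrite -bigcup_seq/=; exists i => /=; first by rewrite mem_index_enum.
by exists Y => //; rewrite setTI.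
Qed.

Lemma measurable_fun_rV d (T : measurableType d) (f : T -> 'rV[R]_n) :
  (forall i, measurable_fun [set: T] (fun t => f t ord0 i : R)) ->
  measurable_fun [set: T] f.
Proof.
move=> mf _; apply: (@smallest_sub _ _ _ [set B | measurable (setT `&` f @^-1` B)]).
- split=> /=.
  + by rewrite preimage_set0 setI0.
  + by move=> A; rewrite !setTI setTD -preimage_setC => /measurableC.
  + by move=> F mF; rewrite setTI preimage_bigcup; apply: bigcup_measurable => k _;
    have := mF k; rewrite setTI.
- rewrite -bigcup_seq/= => B [i _ [A mA <-]] /=.
  by rewrite setTI; exact: mf.
Qed.

End measurable_rV.

Section lebesgue_rV.
Context {R : realType}.

Definition row_cons n (p : measurableTypeR R * 'rV[R]_n) : 'rV[R]_n.+1 :=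
  \row_i oapp (fun j => p.2 ord0 j) p.1 (unlift ord0 i).

Definition row_uncons n (x : 'rV[R]_n.+1) : measurableTypeR R * 'rV[R]_n :=
  (x ord0 ord0, \row_j x ord0 (lift ord0 j)).

Lemma row_consK n : cancel (@row_cons n) (@row_uncons n).
Proof.
move=> [a x]; congr pair; first by rewrite mxE unlift_none.
by apply/rowP => j; rewrite !mxE liftK.
Qed.

Lemma measurable_row_cons n : measurable_fun setT (@row_cons n).
Proof.
apply: measurable_fun_rV => i.
under eq_fun do rewrite mxE.
case: unliftP => [j _|_] /=; last exact: measurable_fst.
exact: (measurableT_comp (measurable_coord j) measurable_snd).
Qed.

Lemma measurable_row_uncons n : measurable_fun setT (@row_uncons n).
Proof.
apply/measurable_fun_pairP; split; first exact: measurable_coord.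
apply: measurable_fun_rV => i /=.
under eq_fun do rewrite mxE.
exact: measurable_coord.
Qed.

Section lebesgue_step.
Variables (n : nat) (mu : {sigma_finite_measure set 'rV[R]_n -> \bar R}).

Let leb1 : {sigma_finite_measure set (measurableTypeR R) -> \bar R} :=
  @lebesgue_measure R.

Let step : set 'rV[R]_n.+1 -> \bar R :=
  pushforward (leb1 \x mu)%E (@row_cons n).

Let mcons := @measurable_row_cons n.

Let step0 : step set0 = 0%E.
Proof. exact: (measure0 (pushforward (leb1 \x mu)%E (@row_cons n))). Qed.

Let step_ge0 A : (0 <= step A)%E.
Proof. exact: (measure_ge0 (pushforward (leb1 \x mu)%E (@row_cons n))). Qed.

Let step_sigma_additive : semi_sigma_additive step.
Proof.
exact: (@measure_semi_sigma_additive _ _ _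
  (pushforward (leb1 \x mu)%E (@row_cons n))).
Qed.

HB.instance Definition _ :=
  isMeasure.Build _ _ _ step step0 step_ge0 step_sigma_additive.

Let step_sigma_finite : sigma_finite setT step.
Proof.
have /sigma_finiteP[F [TF ndF Foo]] := sigma_finiteT leb1.
have /sigma_finiteP[G [TG ndG Goo]] := sigma_finiteT mu.
exists (fun k => @row_uncons n @^-1` (F k `*` G k)).
  rewrite -preimage_bigcup (_ : \bigcup_k _ = setT) ?preimage_setT//.
  rewrite -setXTT TF TG predeqE => -[x y]; split.
    by move=> [k _ []/= ? ?]; split; exists k.
  move=> [/= [k _ Fx] [l _ Gy]]; exists (maxn k l) => //; split.
  - by move: x Fx; exact/subsetPset/ndF/leq_maxl.
  - by move: y Gy; exact/subsetPset/ndG/leq_maxr.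
move=> k; have [mF Fk] := Foo k; have [mG Gk] := Goo k; split.
  rewrite -[X in measurable X]setTI; apply: measurable_row_uncons => //.
  exact: measurableX.
rewrite /step /pushforward -comp_preimage (_ : _ \o _ = id); last first.
  by apply/funext => p /=; rewrite row_consK.
by rewrite preimage_id product_measure1E// lte_mul_pinfty// ge0_fin_numE.
Qed.

HB.instance Definition _ :=
  Measure_isSigmaFinite.Build _ _ _ step step_sigma_finite.

Definition lebesgue_step : {sigma_finite_measure set 'rV[R]_n.+1 -> \bar R} :=
  step.

End lebesgue_step.

(* Lebesgue measure on R^n: iterated product of the one-dimensional one. *)
Fixpoint lebesgue_rV n : {sigma_finite_measure set 'rV[R]_n -> \bar R} :=
  match n with
  | 0 => \d_(0 : 'rV[R]_0)
  | m.+1 => lebesgue_step (lebesgue_rV m)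
  end.

Lemma lebesgue_rVS n A : lebesgue_rV n.+1 A =
  (@lebesgue_measure R \x lebesgue_rV n)%E (@row_cons n @^-1` A).
Proof. by []. Qed.

End lebesgue_rV.

Section euclidean.
Context {R : realType} {d : nat}.
Implicit Types (x y z : 'rV[R]_d) (A : set 'rV[R]_d).

Definition dotp x y : R := \sum_(i < d) x ord0 i * y ord0 i.

(* The library norm of 'rV[R]_d is the sup norm. *)
Definition enorm x : R := Num.sqrt (dotp x x).

Definition euclid_dist x A : R := inf [set enorm (x - z) | z in A].

Definition ediam A : R := sup [set enorm (p.1 - p.2) | p in A `*` A].

Definition boundary A : set 'rV[R]_d := closure A `\` A°.

(* Near each boundary point, in the direction e, A lies strictly above the
   graph of a Lipschitz function of the component orthogonal to e. *)
Definition lipschitz_boundary A := forall p, boundary A p ->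
  exists (r L : R) (e : 'rV[R]_d) (f : 'rV[R]_d -> R),
    [/\ 0 < r, dotp e e = 1,
        forall y z, `|f y - f z| <= L * enorm (y - z) &
        forall x, enorm (x - p) < r ->
          (A x <-> f (x - dotp x e *: e) < dotp x e)].

Definition lipschitz_convex_domain A :=
  [/\ A !=set0, open A, bounded_set A,
      @convex_set R 'rV[R]_d A & lipschitz_boundary A].

End euclidean.

Section nonlocal.
Context {R : realType} {d : nat}.
Local Notation E := 'rV[R]_d.
Local Notation mu := (lebesgue_rV d).
Implicit Types (Omega D : set E) (gamma : E -> E -> R) (u v f : E -> R).

Definition interaction_domain (delta : R) Omega : set E :=
  [set y | ~ Omega y /\ euclid_dist y (boundary Omega) < delta].

Definition full_domain (delta : R) Omega : set E :=
  Omega `|` interaction_domain delta Omega.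

Definition nl_ball D (r : R) (x : E) : set E :=
  [set y | D y /\ enorm (y - x) <= r].

Definition kernel_K1 D (delta : R) gamma := exists2 gamma0 : R, 0 < gamma0 &
  forall x, D x ->
    (forall y, nl_ball D (delta / 2) x y -> gamma0 <= gamma x y) /\
    (forall y, (D `\` nl_ball D delta x) y -> gamma x y = 0).

Definition kernel_K2 gamma (tgamma : R -> R) :=
  [/\ forall x y, gamma x y = tgamma (enorm (y - x)),
      forall x y, 0 <= gamma x y,
      measurable_fun [set: E] (fun z : E => tgamma (enorm z)) &
      (\int[mu]_z (tgamma (enorm z))%:E = 1)%E].

Definition nonlocal_op gamma u (x : E) : R :=
  \int[mu]_y ((u y - u x) * gamma x y).

Definition L2norm D f : \bar R := 'N[mu]_(2%:E)[(EFin \o f) \_ D]%E.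

Definition square_integrable D f :=
  measurable_fun D f /\ (L2norm D f < +oo)%E.

Definition energy_norm D gamma v : \bar R :=
  ((\int[mu]_(x in D) \int[mu]_(y in D) ((v y - v x) ^+ 2 * gamma x y)%:E)
    `^ 2^-1)%E.

Definition nonlocal_solution (delta : R) Omega gamma (b u : E -> R) :=
  [/\ square_integrable (full_domain delta Omega) u,
      {ae mu, forall x, interaction_domain delta Omega x -> u x = 0} &
      {ae mu, forall x, Omega x -> - nonlocal_op gamma u x = b x}].

End nonlocal.

Section mesh.
Context {R : realType} {d : nat}.
Local Notation E := 'rV[R]_d.

(* An element is given by the set of its vertices. *)
Definition mesh := {fset {fset E}}.

Implicit Types (T : mesh) (K : {fset E}) (Omega D : set E).

Definition hull K : set E := [set x | exists w : E -> R,
  [/\ forall z, z \in K -> 0 <= w z, \sum_(z <- K) w z = 1 &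
      x = \sum_(z <- K) w z *: z]].

Definition affinely_independent K := forall w : E -> R,
  \sum_(z <- K) w z = 0 -> \sum_(z <- K) w z *: z = 0 ->
  forall z, z \in K -> w z = 0.

Definition simplex K := #|` K| = d.+1 /\ affinely_independent K.

Definition conforming T :=
  (forall K, K \in T -> simplex K) /\
  (forall K K', K \in T -> K' \in T -> hull K `&` hull K' = hull (K `&` K')%fset).

Definition region T : set E := \bigcup_(K in [set` T]) hull K.

Definition nodes T : {fset E} := (\bigcup_(K <- T) K)%fset.

Definition mesh_size T : R := \big[Num.max/0]_(K <- T) ediam (hull K).

Definition incircle_diam (A : set E) : R :=
  sup [set 2 * r | r in [set r | 0 <= r /\
    exists c : E, [set x | enorm (x - c) <= r] `<=` A]].

Definition submesh T Omega : mesh :=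
  [fset K in T | `[< (hull K `<=` closure Omega)%classic >]]%fset.

Definition discrete_domain T Omega : set E := region (submesh T Omega).

(* A domain with a curved boundary, such as the union of Omega and its
   interaction domain, is triangulated by an inscribed polytope. *)
Definition inscribed_triangulation T D :=
  [/\ conforming T, region T `<=` closure D &
      forall z, z \in nodes T -> boundary (region T) z -> boundary D z].

(* The elements contained in the closure of Omega cover it. Covering is needed:
   if discrete_domain misses a part of Omega of positive measure, then for the
   data b whose solution is the indicator of Omega the solution restricted to
   discrete_domain belongs to the discrete space but does not solve the discrete
   problem. *)
Definition simultaneously_triangulates T Omega :=
  discrete_domain T Omega = closure Omega.

(* T h is the mesh of size h; Hs is the set of mesh sizes of the family. *)
Definition mesh_family (delta : R) Omega (Hs : set R) (T : R -> mesh) :=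
  [/\ Hs `<=` [set h | 0 < h], closure Hs 0 &
      forall h, Hs h ->
        [/\ inscribed_triangulation (T h) (full_domain delta Omega),
            simultaneously_triangulates (T h) Omega & mesh_size (T h) = h]].

Definition shape_regular (Hs : set R) (T : R -> mesh) :=
  exists2 sigma : R, 0 < sigma & forall h K, Hs h -> K \in T h ->
    ediam (hull K) <= sigma * incircle_diam (hull K).

Definition quasi_uniform (Hs : set R) (T : R -> mesh) :=
  exists2 tau : R, 0 < tau & forall h K, Hs h -> K \in T h ->
    h <= tau * ediam (hull K).

Definition affine_on (A : set E) (f : E -> R) :=
  exists (a : E) (c : R), forall x, A x -> f x = dotp a x + c.

(* phi z is the nodal basis function of the node z. *)
Definition nodal_basis T (phi : E -> E -> R) :=
  forall z, z \in nodes T ->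
    [/\ {within region T, continuous (phi z)},
        forall K, K \in T -> affine_on (hull K) (phi z) &
        forall z', z' \in nodes T -> phi z z' = (z' == z)%:R].

Definition Vpc_c0 T Omega (phi : E -> E -> R) : set (E -> R) :=
  [set v | exists c : E -> R, v = fun x =>
    \sum_(z <- nodes T | `[< discrete_domain T Omega z >])
      c z * (phi z \_ (discrete_domain T Omega)) x].

(* b lives on Omega; the null set where discrete_domain meets the boundary of
   Omega is taken care of by extending b by zero. *)
Definition discrete_solution Omega (Omega_h : set E) (V : set (E -> R))
    (gamma : E -> E -> R) (b uh : E -> R) :=
  V uh /\ forall w, V w ->
    - (\int[lebesgue_rV d]_(x in Omega_h) (nonlocal_op gamma uh x * w x)) =
    \int[lebesgue_rV d]_(x in Omega_h) ((b \_ Omega) x * w x).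

End mesh.

Arguments mesh : clear implicits.

(* Main.v *)
Require Import Defs.
From HB Require Import structures.
From mathcomp Require Import all_boot all_order all_algebra finmap.
From mathcomp Require Import all_classical all_reals all_analysis.
From mathcomp Require Import measurable_realfun ring lra.

Set Implicit Arguments.
Unset Strict Implicit.
Unset Printing Implicit Defensive.

Import Order.TTheory GRing.Theory Num.Theory.
Import numFieldNormedType.Exports.

Local Open Scope classical_set_scope.
Local Open Scope ring_scope.

(**
Write k z for the value of the kernel at the length of z, so that the kernel
between x and y is k (y - x). Everything reduces to functions supported in
Omega. Indeed the meshes cover the closure of Omega, and the boundary of Omega
is a null set, so u, u_h and the elements of the discrete space may be replaced
by their restrictions to Omega. For such functions the kernel vanishes between
the support and the complement of the full domain, hence the squared energy norm
is the value on the diagonal of the symmetric nonnegative form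
a(v, w) = integral over R^d x R^d of (v y - v x) (w y - w x) k (y - x), which
is bounded by 4 times the L2 norm squared because k has integral 1
([energy_norm_restrict], [form_le]).

Energy estimate. By Fubini and the symmetry of k, a(v, w) is -2 times the
integral of (L v) w ([form_nonlocal_op]). Subtracting the two weak equations
gives a(u - u_h, w) = 0 for all discrete w ([galerkin_orthogonality]), and
Pythagoras gives the first claim ([form_pythagoras]).

L2 estimate. The form is coercive ([nonlocal_poincare]): if A z is the squared
L2 norm of v (x + z) - v x, then a(v, v) is the integral of k z times A z, and
A (2 z) <= 4 A z. After m doublings of z the two translates of v have disjoint
supports, provided z is not too short, so A z >= 4^-m 2 |v|^2 for those z. As
the kernel has unit mass and a point is a null set, some m leaves a positive
amount of kernel mass on such z. Coercivity, boundedness of the form and the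
energy estimate make u_h quasi-optimal in L2 (an argument of Cea type).

The minimum over the discrete space is attained because the space is spanned by
finitely many functions ([least_squares]). It tends to 0 because Lipschitz
functions are dense in L2 of Omega ([lipschitz_dense]) and the nodal interpolant
of a function with Lipschitz constant L is within L h of it
([nodal_interpolation]).
*)

(** * Lebesgue measure on row vectors *)

(** The sigma-algebra is generated by the coordinates, the topology by the
    sup norm: an open set is the union of the countably many rational cubes
    that it contains. *)
Lemma open_measurable_rV (R : realType) n (A : set 'rV[R]_n) :
  open A -> measurable A.
Proof.
move=> oA.
pose box (q : 'rV[rat]_n * nat) : set 'rV[R]_n :=
  [set x | forall i, `|ratr (q.1 ord0 i) - x ord0 i| < q.2.+1%:R^-1].
have mbox q : measurable (box q).
  have -> : box q = \bigcap_(i in [set: 'I_n])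
      (fun x : 'rV[R]_n => x ord0 i) @^-1`
        (ball (ratr (q.1 ord0 i) : R) q.2.+1%:R^-1).
    by apply/seteqP; split=> [x bx i _|x bx i]; [exact: bx|exact: bx].
  apply: fin_bigcap_measurable => // i _.
  rewrite -[X in measurable X]setTI; apply: measurable_coord => //.
  exact: measurable_ball.
have -> : A = \bigcup_(q in [set q | box q `<=` A]) box q.
  apply/seteqP; split=> [x Ax|x [q qA /qA//]].
  have /nbhs_ballP[e /= e0 xeA] : nbhs x A by exact: open_nbhs_nbhs.
  have e20 : 0 < e / 2 by rewrite divr_gt0.
  have [k] := ltr_add_invr e20; rewrite add0r => ke.
  have qP i : exists q : rat, `|ratr q - x ord0 i| < k.+1%:R^-1.
    have [|q] := @rat_in_itvoo _ (x ord0 i) (x ord0 i + k.+1%:R^-1).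
      by rewrite ltrDl invr_gt0.
    rewrite in_itv/= => /andP[xq qx]; exists q.
    by rewrite ger0_norm ?subr_ge0 1?ltW// ltrBlDl.
  pose q : 'rV[rat]_n := \row_i xget 0 [set q | `|ratr q - x ord0 i| < k.+1%:R^-1].
  have {qP}qx i : `|ratr (q ord0 i) - x ord0 i| < k.+1%:R^-1.
    by rewrite mxE; case: xgetP => [//|nq]; have [q0 /nq] := qP i.
  exists (q, k) => //= y yq; apply: xeA; split => // i j; rewrite ord1.
  rewrite /ball/= -(subrKA (ratr (q ord0 j))) (le_lt_trans (ler_normD _ _))//.
  by rewrite (splitr e) ltrD// (lt_trans _ ke)// distrC.
rewrite bigcup_mkcond; apply: countable_bigcupT_measurable => // q.
by case: ifP.
Qed.

(** Packages an image measure as a measure, so that it can be compared with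
    other measures through their values on measurable sets. *)
Lemma pushforward_measureP d1 d2 (T1 : measurableType d1)
    (T2 : measurableType d2) (R : realType) (m : {measure set T1 -> \bar R})
    (f : T1 -> T2) : measurable_fun setT f ->
  exists m' : {measure set T2 -> \bar R}, m' = pushforward m f :> (set T2 -> _).
Proof.
move=> mf.
by exists (@measure_function_pushforward__canonical__measure_function_Measure
  _ _ _ _ _ m f mf).
Qed.

Lemma ge0_integral_mscale_comp d (T : measurableType d) (R : realType)
    (m : {measure set T -> \bar R}) (f : T -> T) (k : {nonneg R})
    (g : T -> \bar R) : measurable_fun setT f ->
  (forall A, measurable A -> m (f @^-1` A) = (k%:num%:E * m A)%E) ->
  measurable_fun setT g -> (forall x, 0 <= g x)%E ->
  (\int[m]_x g (f x) = k%:num%:E * \int[m]_x g x)%E.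
Proof.
move=> mf fk mg g0; have [pm pmE] := pushforward_measureP m mf.
have := @ge0_integral_pushforward _ _ _ _ _ f mf m setT g measurableT mg
  (fun y _ => g0 y).
rewrite preimage_setT -pmE => /esym ->.
rewrite -(ge0_integral_mscale m measurableT k mg (fun x _ => g0 x)).
apply: (@eq_measure_integral _ _ _ setT (mscale k m) pm) => A mA _.
by rewrite pmE; exact: fk.
Qed.

Lemma lebesgue_measure_affine (R : realType) (a b : R) (A : set R) :
  0 < a -> measurable A ->
  lebesgue_measure ((fun x => a * x + b) @^-1` A) =
  ((a^-1)%:E * lebesgue_measure A)%E.
Proof.
move=> a0 mA.
pose f (x : measurableTypeR R) : measurableTypeR R := a * x + b.
have mf : measurable_fun setT f.
  by apply: measurable_funD => //; exact: measurable_funM.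
have [pm pmE] := pushforward_measureP lebesgue_measure mf.
pose m := mscale (NngNum (ltW a0)) pm.
have mE : forall A, measurable A -> lebesgue_measure A = m A.
  apply: lebesgue_measure_unique => _ [[x y]] _ <-.
  rewrite /m/= /mscale/= pmE /pushforward.
  have -> : f @^-1` `]x, y] = (`](x - b) / a, (y - b) / a]%classic : set R).
    apply/seteqP; split=> z; rewrite /= !in_itv/= /f;
      by rewrite ltr_pdivrMr// ler_pdivlMr// ltrBlDr lerBrDr mulrC.
  have itvE u v : lebesgue_measure (`]u, v]%classic : set R) =
      if u < v then (v - u)%:E else 0%E.
    by rewrite lebesgue_measure_itv/= lte_fin EFinB.
  rewrite [LHS]itvE [X in (_ * X)%E]itvE.
  have -> : ((x - b) / a < (y - b) / a) = (x < y).
    by rewrite ltr_pM2r ?invr_gt0// ltrD2r.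
  case: ifPn => _; last by rewrite mule0.
  by rewrite -EFinM -mulrBl mulrC divfK ?gt_eqF// opprB addrA subrK.
rewrite (mE _ mA) /m/= /mscale/= pmE muleA -EFinM mulVf ?gt_eqF//.
by rewrite mul1e.
Qed.

Lemma measurable_rV_affine (R : realType) n (a : R) (b : 'rV[R]_n) :
  measurable_fun setT (fun x : 'rV[R]_n => a *: x + b).
Proof.
apply: measurable_fun_rV => i; under eq_fun do rewrite !mxE.
apply: measurable_funD => //; apply: measurable_funM => //.
exact: measurable_coord.
Qed.

(** Induction on the dimension: a section of the preimage is the preimage of a
    section under the map on the remaining coordinates, and the first coordinate
    is integrated by the one-dimensional scaling formula. *)
Lemma lebesgue_rV_affine (R : realType) n (a : R) (b : 'rV[R]_n)
    (A : set 'rV[R]_n) : 0 < a -> measurable A ->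
  lebesgue_rV n ((fun x : 'rV[R]_n => a *: x + b) @^-1` A) =
  ((a ^- n)%:E * lebesgue_rV n A)%E.
Proof.
move=> a0; elim: n b A => [|n IHn] b A mA.
  rewrite expr0 invr1 mul1e; congr (lebesgue_rV 0 _); apply/funext => x.
  by rewrite /preimage/=; congr (A _); apply/rowP => -[].
pose b' : 'rV[R]_n := \row_j b ord0 (lift ord0 j).
have mA' : measurable (@row_cons R n @^-1` A).
  by rewrite -[X in measurable X]setTI; exact: measurable_row_cons.
rewrite !lebesgue_rVS /product_measure1/=.
pose g x := lebesgue_rV n (xsection (@row_cons R n @^-1` A) x).
have mg : measurable_fun setT g by exact: measurable_fun_xsection.
transitivity (\int[lebesgue_measure]_x
    ((a ^- n)%:E * (g \o (fun x => (a * x + b ord0 ord0)%R)) x))%E.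
  apply: eq_integral => x _; rewrite /g/= -(IHn b'); last first.
    exact: measurable_xsection.
  congr (lebesgue_rV n _); apply/funext => y.
  rewrite /xsection/= !inE/=; congr (A _).
  apply/rowP => i; rewrite !mxE.
  by case: unliftP => [j ->|->]; rewrite /= ?mxE.
pose f (x : measurableTypeR R) : measurableTypeR R := a * x + b ord0 ord0.
have mf : measurable_fun setT f.
  by apply: measurable_funD => //; exact: measurable_funM.
rewrite ge0_integralZl_EFin//=; first last.
- by rewrite invr_ge0 exprn_ge0// ltW.
- exact: (measurableT_comp mg mf).
have ai0 : 0 < a^-1 by rewrite invr_gt0.
rewrite exprS invfM mulrC EFinM -muleA; congr (_ * _)%E.
exact: (ge0_integral_mscale_comp (k := NngNum (ltW ai0)) mf
  (fun B mB => lebesgue_measure_affine _ a0 mB) mg).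
Qed.

Lemma ge0_integral_rV_shift (R : realType) n (b : 'rV[R]_n)
    (f : 'rV[R]_n -> \bar R) : measurable_fun setT f -> (forall x, 0 <= f x)%E ->
  (\int[lebesgue_rV n]_x f (x + b)%R = \int[lebesgue_rV n]_x f x)%E.
Proof.
move=> mf f0; have mb := measurable_rV_affine 1 b.
rewrite -[RHS]mul1e -(ge0_integral_mscale_comp (k := 1%:nng) mb _ mf)//.
  by under [RHS]eq_integral do rewrite /= scale1r.
move=> A mA; have := lebesgue_rV_affine b ltr01 mA.
by rewrite expr1n invr1.
Qed.

(** A bounded set lies in a cube, and the section of a cube is a cube. *)
Lemma lebesgue_rV_bounded_lty (R : realType) n (r : R) (A : set 'rV[R]_n) :
  measurable A -> (forall x, A x -> forall i, `|x ord0 i| <= r) ->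
  (lebesgue_rV n A < +oo)%E.
Proof.
elim: n A => [|n IHn] A mA Ar.
  by rewrite /= diracE; case: (_ \in _); rewrite ltry.
pose B : set 'rV[R]_n := [set x | forall i, `|x ord0 i| <= r].
have mB : measurable B.
  have -> : B = \bigcap_(i in [set: 'I_n])
      (fun x : 'rV[R]_n => x ord0 i) @^-1` `[- r, r].
    apply/seteqP; split=> [x Bx i _|x Bx i] /=.
      by rewrite in_itv/= -ler_norml; exact: Bx.
    by have := Bx i I; rewrite /= in_itv/= -ler_norml.
  apply: fin_bigcap_measurable => // i _.
  by rewrite -[X in measurable X]setTI; apply: measurable_coord.
rewrite lebesgue_rVS.
have AB : @row_cons R n @^-1` A `<=` `[- r, r]%classic `*` B.
  move=> [x y] /= /Ar xyr; split=> [|i] /=.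
    by have := xyr ord0; rewrite mxE unlift_none/= in_itv/= -ler_norml.
  by have := xyr (lift ord0 i); rewrite mxE liftK.
apply: le_lt_trans (le_measure _ _ _ AB) _; rewrite ?inE//.
- by rewrite -[X in measurable X]setTI; exact: measurable_row_cons.
- exact: measurableX.
rewrite /= product_measure1E//= lte_mul_pinfty//.
- by rewrite ge0_fin_numE// lebesgue_measure_itv/=; case: ifP => _; rewrite ltry.
- exact: IHn.
Qed.

Lemma measurable_set1_rV (R : realType) n (x : 'rV[R]_n) : measurable [set x].
Proof.
have -> : [set x] = \bigcap_(i in [set: 'I_n])
    (fun y : 'rV[R]_n => y ord0 i) @^-1` [set x ord0 i].
  apply/seteqP; split=> [y -> //|y yx].
  by apply/rowP => i; exact: yx.
apply: fin_bigcap_measurable => // i _.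
by rewrite -[X in measurable X]setTI; apply: measurable_coord.
Qed.

Lemma lebesgue_rV_origin (R : realType) n : lebesgue_rV n.+1 [set 0 : 'rV[R]_n.+1] = 0%E.
Proof.
rewrite lebesgue_rVS.
have -> : @row_cons R n @^-1` [set 0] = [set 0] `*` [set 0].
  apply/seteqP; split=> -[x y] /=; last first.
    move=> [-> ->]; apply/rowP => i; rewrite !mxE.
    by case: unliftP => [j _|_] //=; rewrite mxE.
  move=> /rowP xy0; split.
    by have := xy0 ord0; rewrite !mxE unlift_none.
  by apply/rowP => i; have := xy0 (lift ord0 i); rewrite !mxE liftK.
have m0 := measurable_set1_rV (0 : 'rV[R]_n).
rewrite product_measure1E//.
by have /= -> := lebesgue_measure_set1 (0 : R); rewrite mul0e.
Qed.

Lemma closed_measurable_rV (R : realType) n (A : set 'rV[R]_n) :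
  closed A -> measurable A.
Proof.
move=> cA; rewrite -(setCK A); apply: measurableC.
by apply: open_measurable_rV; exact: closed_openC.
Qed.

(** * The Euclidean norm and the domain *)

Section enorm_facts.
Context {R : realType} {d : nat}.
Implicit Types x y z : 'rV[R]_d.

Lemma dotp_ge0 x : 0 <= dotp x x.
Proof. by apply: sumr_ge0 => i _; exact: sqr_ge0. Qed.

Lemma enorm_ge0 x : 0 <= enorm x.
Proof. exact: sqrtr_ge0. Qed.

Lemma enormZ (a : R) x : enorm (a *: x) = `|a| * enorm x.
Proof.
rewrite /enorm (_ : dotp _ _ = a ^+ 2 * dotp x x).
  by rewrite sqrtrM ?sqr_ge0// sqrtr_sqr.
by rewrite /dotp mulr_sumr; apply: eq_bigr => i _; rewrite mxE; ring.
Qed.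

Lemma coord_le_enorm x i : `|x ord0 i| <= enorm x.
Proof.
rewrite -sqrtr_sqr ler_sqrt ?dotp_ge0// /dotp (bigD1 i)//= expr2 lerDl.
by apply: sumr_ge0 => j _; exact: sqr_ge0.
Qed.

Lemma enorm_le_sum x : enorm x <= \sum_(i < d) `|x ord0 i|.
Proof.
have s0 (s : seq 'I_d) : 0 <= \sum_(i <- s) `|x ord0 i|.
  by apply: sumr_ge0.
rewrite -(ger0_norm (s0 _)) -sqrtr_sqr ler_sqrt ?sqr_ge0// /dotp.
elim: (index_enum 'I_d) => [|i s ih]; first by rewrite !big_nil expr0n.
rewrite !big_cons sqrrD (_ : x ord0 i * x ord0 i = `|x ord0 i| ^+ 2); last first.
  by rewrite real_normK ?num_real.
rewrite -addrA lerD2l.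
by rewrite (le_trans ih)// lerDr mulrn_wge0// mulr_ge0.
Qed.

Lemma enorm_continuous : continuous (@enorm R d).
Proof.
move=> x; apply: (@continuous_comp _ _ _ (fun x => dotp x x) Num.sqrt);
  last exact: sqrt_continuous.
rewrite /dotp; elim: (index_enum 'I_d) => [|i s ih].
  rewrite (_ : (fun _ => _) = cst 0); first exact: cst_continuous.
  by apply/funext => y; rewrite big_nil.
rewrite (_ : (fun _ => _) = (fun y : 'rV[R]_d => y ord0 i * y ord0 i +
    \sum_(j <- s) y ord0 j * y ord0 j)); last first.
  by apply/funext => y; rewrite big_cons.
by apply: (cvgD _ ih); apply: cvgM; exact: coord_continuous.
Qed.

Lemma open_enorm_ball z (r : R) : open [set y | enorm (y - z) < r].
Proof.
have cf : continuous (fun y => enorm (y - z)).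
  move=> y; apply: (@continuous_comp _ _ _ (fun y => y - z)).
    by apply: (cvgB cvg_id); exact: cvg_cst.
  exact: enorm_continuous.
rewrite (_ : [set _ | _] = (fun y => enorm (y - z)) @^-1` [set t | t < r])//.
by apply: open_comp; [move=> y _; exact: cf|exact: open_lt].
Qed.

Lemma euclid_dist_le x z (A : set 'rV[R]_d) : A z ->
  euclid_dist x A <= enorm (x - z).
Proof.
move=> Az; apply: ge_inf; last by exists z.
by exists 0 => _ [y _ <-]; exact: enorm_ge0.
Qed.

Lemma open_euclid_dist (A : set 'rV[R]_d) (r : R) :
  open [set y | euclid_dist y A < r].
Proof.
have [->|A0] := eqVneq A set0.
  have E y : euclid_dist y set0 = 0 by rewrite /euclid_dist image_set0 inf0.
  have [r0|r0] := ltP 0 r.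
    rewrite (_ : [set _ | _] = setT); first exact: openT.
    by apply/seteqP; split=> // y _ /=; rewrite E.
  rewrite (_ : [set _ | _] = set0); first exact: open0.
  by apply/seteqP; split=> // y /=; rewrite E ltNge r0.
rewrite (_ : [set _ | _] = \bigcup_(z in A) [set y | enorm (y - z) < r]).
  by apply: bigcup_open => z _; exact: open_enorm_ball.
apply/seteqP; split=> y /=.
  by move=> /inf_lt[|_ [z Az <-] yz]; [exact/image_nonempty/set0P|exists z].
by move=> [z Az]; apply: le_lt_trans; exact: euclid_dist_le.
Qed.

End enorm_facts.

Section domain.
Context {R : realType} {d : nat}.
Implicit Types (Omega : set 'rV[R]_d) (delta : R).

Lemma open_full_domain delta Omega :
  open Omega -> open (full_domain delta Omega).
Proof.
move=> oO; rewrite (_ : full_domain _ _ =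
    Omega `|` [set y | euclid_dist y (boundary Omega) < delta]).
  by apply: openU => //; exact: open_euclid_dist.
apply/seteqP; split=> y [Oy|]; [by left|by case; right|by left|].
by move=> yd; have [Oy|nOy] := pselect (Omega y); [left|right].
Qed.

(** The segment from x to y leaves Omega at a boundary point other than x, which
    is therefore at distance less than delta from y. *)
Lemma full_domain_near delta Omega x y : open Omega -> 0 < delta ->
  Omega x -> enorm (y - x) <= delta -> full_domain delta Omega y.
Proof.
move=> oO delta0 Ox yx; have [Oy|nOy] := pselect (Omega y); [by left|right].
split=> //.
pose g (t : R) := x + t *: (y - x).
have cg : continuous g.
  move=> t; apply: cvgD; first exact: cvg_cst.
  by apply: cvgZr_tmp; exact: cvg_id.
pose S := [set t : R | t <= 1 /\ Omega (g t)].
have S0 : S 0 by split=> //; rewrite /g scale0r addr0.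
have hS : has_sup S by split; [exists 0|exists 1 => t []].
have oS t : Omega (g t) -> exists2 e, 0 < e & forall t', `|t - t'| < e -> Omega (g t').
  move=> Ogt; have /nbhs_ballP[e /= e0 te] : nbhs t (g @^-1` Omega).
    by apply: cg; exact: open_nbhs_nbhs.
  by exists e.
(* The exit parameter; openness of Omega excludes both s = 0 and g s in Omega. *)
pose s := sup S.
have s0 : 0 < s.
  have [|e e0 eO] := oS 0; first by have [] := S0.
  have m0 : 0 < Num.min 1 (e / 2) by rewrite lt_min ltr01 divr_gt0.
  apply: (lt_le_trans m0); apply: sup_upper_bound => //; split.
    by rewrite ge_min lexx.
  apply: eO; rewrite sub0r normrN ger0_norm ?(ltW m0)//.
  by rewrite gt_min; apply/orP; right; rewrite ltr_pdivrMr// ltr_pMr// ltr1n.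
have s1 : s <= 1 by apply: sup_le_ub; [exists 0|move=> t []].
have nOs : ~ Omega (g s).
  move=> Os; have sn1 : s < 1.
    rewrite lt_neqAle s1 andbT; apply/eqP => se; apply: nOy; move: Os.
    by rewrite se /g scale1r addrC subrK.
  have [e e0 eO] := oS _ Os.
  pose t := s + Num.min (1 - s) (e / 2).
  have m0 : 0 < Num.min (1 - s) (e / 2) by rewrite lt_min subr_gt0 sn1 divr_gt0.
  have : t <= s.
    apply: sup_upper_bound => //; split.
      by rewrite /t -lerBrDl ge_min lexx.
    apply: eO; rewrite opprD addNKr normrN ger0_norm ?(ltW m0)//.
    by rewrite gt_min; apply/orP; right; rewrite ltr_pdivrMr// ltr_pMr// ltr1n.
  by rewrite /t gerDl leNgt m0.
have bs : boundary Omega (g s).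
  split; last by rewrite ((interior_id _).1 oO).
  move=> B /cg/nbhs_ballP[e /= e0 sB].
  have [t [t1 Ot] st] := sup_adherent e0 hS.
  exists (g t); split=> //; apply: sB; rewrite /ball/=.
  have ts : t <= s by apply: sup_upper_bound.
  by rewrite ger0_norm ?subr_ge0// ltrBlDr -ltrBlDl.
apply: le_lt_trans (euclid_dist_le _ bs) _.
rewrite (_ : y - g s = (1 - s) *: (y - x)); last first.
  by apply/rowP => i; rewrite !mxE; ring.
rewrite enormZ ger0_norm ?subr_ge0//.
apply: (@le_lt_trans _ _ ((1 - s) * delta)).
  by rewrite ler_wpM2l// subr_ge0.
by rewrite mulrBl mul1r ltrBlDr ltrDl mulr_gt0.
Qed.

Lemma closure_subset_full_domain delta Omega : open Omega -> 0 < delta ->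
  closure Omega `<=` full_domain delta Omega.
Proof.
move=> oO delta0 x cOx; have [Ox|nOx] := pselect (Omega x); [by left|right].
split=> //; apply: le_lt_trans (_ : enorm (x - x) < _).
  by apply: euclid_dist_le; split=> //; rewrite ((interior_id _).1 oO).
by rewrite subrr -(scale0r 0) enormZ normr0 mul0r.
Qed.

Lemma bounded_coord Omega : bounded_set Omega ->
  exists2 r : R, 0 <= r & forall x, Omega x -> forall i, `|x ord0 i| <= r.
Proof.
move=> [M [Mr bM]]; exists (`|M| + 1) => [|x Ox i]; first by rewrite addr_ge0.
have := bM (`|M| + 1); rewrite (le_lt_trans (ler_norm M)) ?ltrDl// => /(_ isT x Ox).
apply: le_trans; rewrite [leRHS]/Num.norm/= mx_normrE.
by apply/bigmax_geP; right; exists (ord0, i).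
Qed.

Lemma convex_setE Omega (s : R) x y : @convex_set R 'rV[R]_d Omega ->
  0 <= s <= 1 -> Omega x -> Omega y -> Omega (s *: x + (1 - s) *: y).
Proof.
move=> cO s01 Ox Oy.
have := cO x y (Itv01 (proj1 (andP s01)) (proj2 (andP s01))).
by rewrite !inE; exact.
Qed.

(** If x' in Omega is close to x, then the point in question is the same convex
    combination of x' and of a small perturbation c' of c, which still lies in
    Omega. *)
Lemma closure_contract Omega (s : R) x c : open Omega ->
  @convex_set R 'rV[R]_d Omega -> 0 < s < 1 -> Omega c ->
  closure Omega x -> Omega (s *: x + (1 - s) *: c).
Proof.
move=> oO cO /andP[s0 s1] Oc cOx.
have /nbhs_ballP[r /= r0 rO] : nbhs c Omega by exact: open_nbhs_nbhs.
have s10 : 0 < 1 - s by rewrite subr_gt0.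
have e0 : 0 < r * (1 - s) / s by rewrite divr_gt0// mulr_gt0.
have [x' [Ox' xx']] := cOx _ (nbhsx_ballx x (r * (1 - s) / s) e0).
pose c' := c + (s / (1 - s)) *: (x - x').
have Oc' : Omega c'.
  apply: rO; rewrite -ball_normE /ball_/= /c' opprD addNKr normrN normrZ.
  rewrite ger0_norm ?divr_ge0 ?ltW//.
  move: xx'; rewrite -ball_normE/= ltr_pdivlMr// => xx'.
  by rewrite mulrAC ltr_pdivrMr// mulrC.
rewrite (_ : _ + _ = s *: x' + (1 - s) *: c').
  by apply: convex_setE => //; rewrite !ltW.
rewrite /c' scalerDr scalerA mulrCA mulfV ?gt_eqF// mulr1.
by apply/rowP => i; rewrite !mxE; ring.
Qed.

Lemma bernoulli_le (e : R) n : 0 <= e <= 1 -> 1 - n%:R * e <= (1 - e) ^+ n.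
Proof.
move=> /andP[e0 e1]; elim: n => [|n ih]; first by rewrite mul0r subr0.
rewrite exprSr; apply: le_trans (_ : (1 - n%:R * e) * (1 - e) <= _); last first.
  by rewrite ler_wpM2r// subr_ge0.
have := mulr_ge0 (ler0n R n) (sqr_ge0 e).
by rewrite -natr1; lra.
Qed.

(** By [closure_contract] the closure is contained in every dilation of Omega
    about an interior point, so its measure is at most s^-d times that of Omega
    for every s < 1. Bernoulli's inequality lets s tend to 1. *)
Lemma convex_boundary_null Omega : Omega !=set0 -> open Omega ->
  bounded_set Omega -> @convex_set R 'rV[R]_d Omega ->
  lebesgue_rV d (closure Omega `\` Omega) = 0%E.
Proof.
move=> [c Oc] oO /bounded_coord[r r0 Or] cO.
have mO := open_measurable_rV oO.
have mC : measurable (closure Omega).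
  by apply: closed_measurable_rV; exact: closed_closure.
have finO : (lebesgue_rV d Omega < +oo)%E by exact: (lebesgue_rV_bounded_lty mO Or).
have key s : 0 < s < 1 ->
    (lebesgue_rV d (closure Omega) <= (s ^- d)%:E * lebesgue_rV d Omega)%E.
  move=> s01; have s0 : 0 < s by case/andP : s01.
  rewrite -(lebesgue_rV_affine ((1 - s) *: c) s0 mO).
  apply: le_measure; rewrite ?inE//.
    rewrite -[X in measurable X]setTI.
    exact: (measurable_rV_affine s ((1 - s) *: c)).
  by move=> x cx /=; exact: closure_contract.
have finC : (lebesgue_rV d (closure Omega) < +oo)%E.
  apply: le_lt_trans (key 2^-1 _) _; first by lra.
  by rewrite lte_mul_pinfty// lee_fin invr_ge0 exprn_ge0.
rewrite measureD// setIidr; last exact: subset_closure.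
suff : (lebesgue_rV d (closure Omega) <= lebesgue_rV d Omega)%E.
  move=> CO; apply/eqP; rewrite eq_le; apply/andP; split.
    by rewrite leeBlDr ?add0e// ge0_fin_numE.
  rewrite leeBrDr ?add0e ?ge0_fin_numE//.
  by apply: le_measure; rewrite ?inE//; exact: subset_closure.
move: finC finO key.
rewrite -!ge0_fin_numE// => /fineK <- /fineK <-.
set mC' := fine _; set mO' := fine _ => key.
have mC0 : 0 <= mC' by exact: fine_ge0.
rewrite lee_fin; apply/ler_addgt0Pr => e e0.
(* The error d h mC' coming from Bernoulli's inequality is at most e. *)
pose h := Num.min (1 / 2) (e / (d%:R * mC' + 1)).
have D0 : 0 < d%:R * mC' + 1 by rewrite ltr_wpDl// mulr_ge0.
have h0 : 0 < h by rewrite lt_min !divr_gt0.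
have h1 : h <= 1 / 2 by rewrite ge_min lexx.
have he : h * (d%:R * mC' + 1) <= e.
  by rewrite -ler_pdivlMr// ge_min lexx orbT.
have := key (1 - h); rewrite -EFinM lee_fin ler_pdivlMl; last first.
  by rewrite exprn_gt0//; lra.
move=> /(_ ltac:(lra)) kh.
have := @bernoulli_le h d ltac:(lra) => /(ler_wpM2r mC0).
by move: he kh; lra.
Qed.
End domain.

(** * The energy form *)

(** Parameter integrals of a function without sign or integrability
    assumption: both parts are covered by Tonelli's theorem. *)
Lemma measurable_fun_integral2 d1 d2 (T1 : measurableType d1)
    (T2 : measurableType d2) (R : realType)
    (m : {sigma_finite_measure set T2 -> \bar R}) (f : T1 * T2 -> \bar R) :
  measurable_fun setT f -> measurable_fun setT (fun x => \int[m]_y f (x, y))%E.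
Proof.
move=> mf.
rewrite (_ : (fun _ => _) = ((fun x => \int[m]_y (f^\+%E (x, y))) \-
  (fun x => \int[m]_y (f^\-%E (x, y))))%E).
  apply: emeasurable_funB.
    apply: (measurable_fun_fubini_tonelli_F (f^\+%E)) => //.
    exact: measurable_funepos.
  apply: (measurable_fun_fubini_tonelli_F (f^\-%E)) => //.
  exact: measurable_funeneg.
apply/funext => x; rewrite [LHS]integralE.
under eq_integral do rewrite funepos_comp/=.
by under [X in (_ - X)%E = _]eq_integral do rewrite funeneg_comp/=.
Qed.

(** The three bounds below dominate the integrands of the form by the sum of
    squares whose integrability against the kernel is [integrable_Q]. *)
Lemma normM_diff_le (R : realDomainType) (a b c e : R) :
  `|(b - a) * (e - c)| <= 2 * (a ^+ 2 + b ^+ 2 + (c ^+ 2 + e ^+ 2)).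
Proof.
have := sqr_ge0 (b - a + (e - c)); have := sqr_ge0 (b - a - (e - c)).
have := sqr_ge0 (a + b); have := sqr_ge0 (c + e); have := sqr_ge0 a.
have := sqr_ge0 b; have := sqr_ge0 c; have := sqr_ge0 e.
by rewrite ler_norml; move=> *; apply/andP; split; lra.
Qed.

Lemma normM_diff_le1 (R : realDomainType) (a b c e : R) :
  `|(b - a) * c| <= 2 * (a ^+ 2 + b ^+ 2 + (c ^+ 2 + e ^+ 2)).
Proof.
have := sqr_ge0 (b - a + c); have := sqr_ge0 (b - a - c).
have := sqr_ge0 (a + b); have := sqr_ge0 a.
have := sqr_ge0 b; have := sqr_ge0 c; have := sqr_ge0 e.
by rewrite ler_norml; move=> *; apply/andP; split; lra.
Qed.

Lemma normM_diff_le2 (R : realDomainType) (a b c e : R) :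
  `|(b - a) * e| <= 2 * (a ^+ 2 + b ^+ 2 + (c ^+ 2 + e ^+ 2)).
Proof. by rewrite [c ^+ 2 + _]addrC normM_diff_le1. Qed.

Section energy.
Context {R : realType} {d : nat}.
Local Notation E := 'rV[R]_d.
Local Notation mu := (lebesgue_rV d).
Implicit Types (v w : E -> R).

Definition L2 v := measurable_fun setT v /\
  mu.-integrable setT (fun x => (v x ^+ 2)%:E).

Definition sqnorm v : R := \int[mu]_x (v x ^+ 2).

Lemma sqnormE v : L2 v -> (\int[mu]_x (v x ^+ 2)%:E = (sqnorm v)%:E)%E.
Proof. by move=> [mv iv]; rewrite fineK// integrable_fin_num. Qed.

Lemma sqnorm_ge0 v : 0 <= sqnorm v.
Proof. by apply: Rintegral_ge0 => x _; exact: sqr_ge0. Qed.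

Lemma L2_le (F : E -> R) v w : measurable_fun setT F -> L2 v -> L2 w ->
  (forall x, `|F x| <= v x ^+ 2 + w x ^+ 2) ->
  mu.-integrable setT (EFin \o F).
Proof.
move=> mF [mv iv] [mw iw] Fle.
apply: (le_integrable _ _ _ (integrableD _ iv iw)) => //.
  exact/measurable_EFinP.
move=> x _ /=; rewrite lee_fin (le_trans (Fle x))// ler_norm//.
Qed.

Lemma L2_mul v w : L2 v -> L2 w ->
  mu.-integrable setT (EFin \o (fun x => v x * w x)).
Proof.
move=> hv hw; apply: (L2_le _ hv hw).
  by apply: measurable_funM; [case: hv|case: hw].
move=> x; rewrite normrM.
have := sqr_ge0 (`|v x| - `|w x|); have := sqr_ge0 `|v x|.
rewrite -(real_normK (num_real (v x))) -(real_normK (num_real (w x))).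
have := sqr_ge0 `|w x|; lra.
Qed.

Lemma L2D v w : L2 v -> L2 w -> L2 (fun x => v x + w x).
Proof.
move=> hv hw; have [mv iv] := hv; have [mw iw] := hw.
have mD : measurable_fun setT (fun x => v x + w x) by exact: measurable_funD.
split=> //; have := L2_mul hv hw => ivw.
have := integrableD measurableT (integrableD measurableT iv iw)
  (integrableZl measurableT 2 ivw).
apply: eq_integrable => // x _ /=; rewrite -EFinM -!EFinD; congr (_%:E); ring.
Qed.

Lemma L2Z (a : R) v : L2 v -> L2 (fun x => a * v x).
Proof.
move=> [mv iv]; split; first exact: measurable_funM.
have := integrableZl measurableT (a ^+ 2) iv.
by apply: eq_integrable => // x _ /=; rewrite -EFinM exprMn.
Qed.

Lemma L2B v w : L2 v -> L2 w -> L2 (fun x => v x - w x).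
Proof.
move=> hv /(L2Z (-1)) /(L2D hv); congr L2; apply/funext => x.
by rewrite mulN1r.
Qed.

Section kernel.
Variable k : E -> R.
Hypotheses (k0 : forall z, 0 <= k z) (mk : measurable_fun setT k).
Hypothesis k1 : (\int[mu]_z (k z)%:E = 1)%E.
Hypothesis kN : forall z, k (- z) = k z.

Let K (p : E * E) := k (p.2 - p.1).

Lemma measurable_kernel : measurable_fun setT K.
Proof.
apply: (measurableT_comp mk); apply: measurable_fun_rV => i.
under eq_fun do rewrite !mxE.
by apply: measurable_funB; apply: (measurableT_comp (measurable_coord i)).
Qed.

Lemma integral_kernel x : (\int[mu]_y (k (y - x))%:E = 1)%E.
Proof.
rewrite (ge0_integral_rV_shift (- x) (f := EFin \o k))//.
exact/measurable_EFinP.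
Qed.

Lemma integral_sqr_kernel v : L2 v ->
  (\int[mu]_x \int[mu]_y (v x ^+ 2 * k (y - x))%:E = (sqnorm v)%:E)%E.
Proof.
move=> hv; rewrite -sqnormE//; apply: eq_integral => x _.
under eq_integral do rewrite EFinM.
rewrite ge0_integralZl_EFin ?sqr_ge0//.
- by rewrite integral_kernel mule1.
- by move=> y _; rewrite lee_fin.
- apply/measurable_EFinP; apply: (measurableT_comp mk) => /=.
  by have := measurable_rV_affine 1 (- x); under eq_fun do rewrite scale1r.
Qed.

(** Every integrand met below is dominated by a multiple of this one. *)
Let Q v (p : E * E) := (v p.1 ^+ 2 + v p.2 ^+ 2) * K p.

Let m1 v : measurable_fun setT v -> measurable_fun setT (fun p : E * E => v p.1).
Proof. by move=> mv; apply: (measurableT_comp mv). Qed.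

Let m2 v : measurable_fun setT v -> measurable_fun setT (fun p : E * E => v p.2).
Proof. by move=> mv; apply: (measurableT_comp mv). Qed.

Lemma integral_Q v : L2 v ->
  (\int[mu \x mu]_p (Q v p)%:E = 2%:E * (sqnorm v)%:E)%E.
Proof.
move=> hv; have [mv _] := hv.
have mv1 : measurable_fun setT (fun p => (v p.1 ^+ 2 * K p)%:E).
  apply/measurable_EFinP; apply: measurable_funM; last exact: measurable_kernel.
  by apply: measurable_funX; exact: m1.
have mv2 : measurable_fun setT (fun p => (v p.2 ^+ 2 * K p)%:E).
  apply/measurable_EFinP; apply: measurable_funM; last exact: measurable_kernel.
  by apply: measurable_funX; exact: m2.
have v10 p : (0 <= (v p.1 ^+ 2 * K p)%:E)%E by apply: mulr_ge0; [exact: sqr_ge0|exact: k0].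
have v20 p : (0 <= (v p.2 ^+ 2 * K p)%:E)%E by apply: mulr_ge0; [exact: sqr_ge0|exact: k0].
rewrite (eq_integral (fun p => (v p.1 ^+ 2 * K p)%:E + (v p.2 ^+ 2 * K p)%:E)%E).
  rewrite ge0_integralD// [X in (X + _)%E]fubini_tonelli1//.
  rewrite [X in (_ + X)%E]fubini_tonelli2//.
  rewrite /fubini_F /fubini_G /= [X in (X + _)%E]integral_sqr_kernel//.
  rewrite [X in (_ + X)%E](_ : _ = (sqnorm v)%:E).
    by rewrite -EFinD -EFinM; congr (_%:E); ring.
  rewrite -(integral_sqr_kernel hv); apply: eq_integral => x _.
  by apply: eq_integral => y _; rewrite /K /= -opprB kN.
by move=> p _; rewrite -EFinD -mulrDl.
Qed.

Lemma integrable_Q v : L2 v -> (mu \x mu)%E.-integrable setT (EFin \o Q v).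
Proof.
move=> hv; have [mv _] := hv; apply/integrableP; split.
  apply/measurable_EFinP; apply: measurable_funM; last exact: measurable_kernel.
  by apply: measurable_funD; apply: measurable_funX; [exact: m1|exact: m2].
rewrite (eq_integral (EFin \o Q v)).
  by rewrite [ltLHS]integral_Q// -EFinM ltry.
move=> p _ /=; rewrite ger0_norm//; apply: mulr_ge0; last exact: k0.
by rewrite addr_ge0// sqr_ge0.
Qed.

Lemma integrable_dominated (F : E * E -> R) v w : L2 v -> L2 w ->
  measurable_fun setT F ->
  (forall p, `|F p| <= 2 * (v p.1 ^+ 2 + v p.2 ^+ 2 + (w p.1 ^+ 2 + w p.2 ^+ 2)) * K p) ->
  (mu \x mu)%E.-integrable setT (EFin \o F).
Proof.
move=> hv hw mF Fle.
apply: (le_integrable _ _ _ (integrableZl _ 2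
  (integrableD _ (integrable_Q hv) (integrable_Q hw)))) => //.
  exact/measurable_EFinP.
move=> p _ /=; rewrite lee_fin (le_trans (Fle p))//.
by rewrite (_ : _ * K p = 2 * (Q v p + Q w p)) ?ler_norm// /Q; ring.
Qed.

Definition form_integrand v w (p : E * E) :=
  (v p.2 - v p.1) * (w p.2 - w p.1) * K p.

(** By symmetry of the kernel, the integrand of the form is minus the sum of
    [cross] at (x, y) and at (y, x). *)
Let cross v w (p : E * E) := (v p.2 - v p.1) * w p.1 * K p.

Lemma integrable_form v w : L2 v -> L2 w ->
  (mu \x mu)%E.-integrable setT (EFin \o form_integrand v w).
Proof.
move=> hv hw; have [mv _] := hv; have [mw _] := hw.
apply: (integrable_dominated hv hw).
  apply: measurable_funM; last exact: measurable_kernel.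
  by apply: measurable_funM; apply: measurable_funB; exact: m1 || exact: m2.
move=> p; rewrite normrM (ger0_norm (k0 _)) ler_wpM2r//.
exact: normM_diff_le.
Qed.

Lemma integrable_cross v w : L2 v -> L2 w ->
  (mu \x mu)%E.-integrable setT (EFin \o cross v w).
Proof.
move=> hv hw; have [mv _] := hv; have [mw _] := hw.
apply: (integrable_dominated hv hw).
  apply: measurable_funM; last exact: measurable_kernel.
  apply: measurable_funM; last exact: m1.
  by apply: measurable_funB; exact: m1 || exact: m2.
move=> p; rewrite normrM (ger0_norm (k0 _)) ler_wpM2r//.
exact: normM_diff_le1.
Qed.

Definition form v w : R := \int[(mu \x mu)%E]_p form_integrand v w p.

Lemma formE v w : L2 v -> L2 w ->
  (\int[mu \x mu]_p (form_integrand v w p)%:E = (form v w)%:E)%E.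
Proof. by move=> hv hw; rewrite fineK// integrable_fin_num//; exact: integrable_form. Qed.

Lemma form_ge0 v : 0 <= form v v.
Proof.
by apply: Rintegral_ge0 => p _; apply: mulr_ge0; rewrite -?expr2 ?sqr_ge0 ?k0.
Qed.

Lemma form_iterated v : L2 v ->
  (\int[mu]_x \int[mu]_y ((v y - v x) ^+ 2 * k (y - x))%:E = (form v v)%:E)%E.
Proof.
move=> hv; rewrite -formE// fubini_tonelli1//.
  by have /integrableP[] := integrable_form hv hv.
by move=> p; rewrite lee_fin; apply: mulr_ge0; rewrite -?expr2 ?sqr_ge0 ?k0.
Qed.

Lemma form_le v : L2 v -> form v v <= 4 * sqnorm v.
Proof.
move=> hv; rewrite -lee_fin -formE//.
rewrite (_ : 4 * _ = 2 * (2 * sqnorm v)); last by ring.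
rewrite EFinM [in leRHS]EFinM -integral_Q// -ge0_integralZl_EFin//.
- apply: ge0_le_integral => //.
  + by move=> p _; rewrite lee_fin; apply: mulr_ge0; rewrite -?expr2 ?sqr_ge0 ?k0.
  + by have /integrableP[] := integrable_form hv hv.
  + have /integrableP[mQ _] := integrable_Q hv.
    exact: measurable_funeM.
  + move=> p _; rewrite -EFinM lee_fin /Q /form_integrand /K.
    have := mulr_ge0 (k0 (p.2 - p.1)) (sqr_ge0 (v p.1 + v p.2)).
    by lra.
- by move=> p _; rewrite lee_fin; apply: mulr_ge0; rewrite ?addr_ge0 ?sqr_ge0 ?k0.
- by have /integrableP[] := integrable_Q hv.
Qed.

Lemma formDl u v w : L2 u -> L2 v -> L2 w ->
  form (fun x => u x + v x) w = form u w + form v w.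
Proof.
move=> hu hv hw; rewrite /form -RintegralD//; try exact: integrable_form.
by apply: eq_Rintegral => p _; rewrite /form_integrand; ring.
Qed.

Lemma formBl u v w : L2 u -> L2 v -> L2 w ->
  form (fun x => u x - v x) w = form u w - form v w.
Proof.
move=> hu hv hw; rewrite /form -RintegralB//; try exact: integrable_form.
by apply: eq_Rintegral => p _; rewrite /form_integrand; ring.
Qed.

Lemma formC v w : form v w = form w v.
Proof.
by apply: eq_Rintegral => p _; rewrite /form_integrand; ring.
Qed.

Lemma form_pythagoras u v : L2 u -> L2 v -> form u v = 0 ->
  form u u <= form (fun x => u x + v x) (fun x => u x + v x).
Proof.
move=> hu hv uv0; rewrite formDl//; last exact: L2D.
rewrite formC (formC v) !formDl// uv0 (formC v) uv0 addr0 add0r.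
by rewrite lerDl form_ge0.
Qed.

Lemma measurable_nonlocal_op v : measurable_fun setT v ->
  measurable_fun setT (nonlocal_op (fun x y => k (y - x)) v).
Proof.
move=> mv; apply: measurableT_comp => //.
apply: (@measurable_fun_integral2 _ _ _ _ _ mu
  (fun p : E * E => ((v p.2 - v p.1) * K p)%:E)).
apply/measurable_EFinP/measurable_funM; last exact: measurable_kernel.
by apply: measurable_funB; exact: m1 || exact: m2.
Qed.

(** The nonlocal Green identity. Swapping the two variables identifies the two
    halves of the form, and Fubini's theorem integrates one half first in y.
    The inner integral is w x times the operator at x for almost every x only:
    where w x is nonzero, integrability of the section provides the inner
    integrability that pulling out w x requires. *)
Lemma form_nonlocal_op v w : L2 v -> L2 w ->
  mu.-integrable setT (EFin \o (fun x => nonlocal_op (fun x y => k (y - x)) v x * w x)) /\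
  form v w = - 2 * \int[mu]_x (nonlocal_op (fun x y => k (y - x)) v x * w x).
Proof.
move=> hv hw; have ic := integrable_cross hv hw.
have [mv _] := hv; have [mw _] := hw.
pose L := nonlocal_op (fun x y => k (y - x)) v.
have mL : measurable_fun setT L by exact: measurable_nonlocal_op.
have LE : ae_eq mu setT (fun x => \int[mu]_y (cross v w (x, y))%:E)%E
    (EFin \o (fun x => L x * w x)).
  have := ae_integrable1 ic; apply: filterS => x ix _ /=.
  have [w0|w0] := eqVneq (w x) 0.
    rewrite w0 mulr0 integral0_eq// => y _; rewrite /cross/= w0.
    by rewrite mulr0 mul0r.
  have ix' : mu.-integrable setT (EFin \o (fun y => (v y - v x) * k (y - x))).
    have := integrableZl measurableT (w x)^-1 ix.
    apply: eq_integrable => // y _; rewrite -EFinM /cross /K /=; congr (_%:E).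
    by rewrite mulrA mulrCA mulVf// mulr1.
  rewrite /L /nonlocal_op -RintegralZr//.
  have -> : (\int[mu]_y (cross v w (x, y))%:E =
      (\int[mu]_y cross v w (x, y))%R%:E)%E.
    by rewrite fineK// integrable_fin_num.
  congr (_%:E); by apply: eq_Rintegral => y _; rewrite /cross /K /=; ring.
have mF := measurable_fubini_F ic.
have iF := integrable_fubini_F ic.
have mLw : measurable_fun setT (EFin \o (fun x => L x * w x)).
  by apply/measurable_EFinP; exact: measurable_funM.
split.
  apply/integrableP; split=> //.
  have /integrableP[_] := iF.
  rewrite (_ : integral _ _ _ = \int[mu]_x `|(L x * w x)%:E|)%E//.
  apply: ae_eq_integral => //; try exact: measurableT_comp.
  by apply: filterS LE => x LEx _; exact: (congr1 abse (LEx I)).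
have LI : \int[mu]_x (L x * w x) = \int[(mu \x mu)%E]_p cross v w p.
  rewrite /Rintegral -(integral12_prod_meas1 ic); congr fine.
  exact/esym/ae_eq_integral.
have ics : (mu \x mu)%E.-integrable setT (EFin \o (fun p => cross v w (p.2, p.1))).
  apply: (integrable_dominated hv hw).
    have /measurable_EFinP mc := measurable_int _ ic.
    apply: (measurableT_comp mc).
    by apply/measurable_fun_pairP; split; [exact: measurable_snd|exact: measurable_fst].
  move=> p; rewrite /cross /K /= -(opprB p.2) kN normrM (ger0_norm (k0 _)).
  by rewrite ler_wpM2r// -normrN -mulNr opprB; exact: normM_diff_le2.
have swapE : \int[(mu \x mu)%E]_p cross v w (p.2, p.1) =
    \int[(mu \x mu)%E]_p cross v w p.
  by rewrite /Rintegral -(integral12_prod_meas1 ic) -(integral21_prod_meas1 ics).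
have : \int[(mu \x mu)%E]_p cross v w p +
    \int[(mu \x mu)%E]_p cross v w (p.2, p.1) = -1 * form v w.
  rewrite -RintegralD//= -RintegralZl//; last exact: integrable_form.
  apply: eq_Rintegral => p _; rewrite /cross /form_integrand /K/=.
  by rewrite -[p.1 - p.2]opprB kN; ring.
by rewrite swapE -/L LI => h; rewrite mulNr mulr_natl mulr2n h mulN1r opprK.
Qed.

End kernel.
End energy.

(** * Coercivity of the form *)
Section poincare.
Context {R : realType} {n : nat}.
Local Notation E := 'rV[R]_n.+1.
Local Notation mu := (lebesgue_rV n.+1).
Variable k : E -> R.
Hypotheses (k0 : forall z, 0 <= k z) (mk : measurable_fun setT k).
Hypothesis k1 : (\int[mu]_z (k z)%:E = 1)%E.
Hypothesis kN : forall z, k (- z) = k z.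
Implicit Types (v : E -> R) (z : E).

(** The squared L2 modulus of continuity of v in the direction z. *)
Definition shift_energy v z : \bar R := (\int[mu]_x ((v (x + z) - v x) ^+ 2)%:E)%E.

Let mshift z : measurable_fun setT (fun x : E => x + z).
Proof. by have := measurable_rV_affine 1 z; under eq_fun do rewrite scale1r. Qed.

Let mdiff v z : measurable_fun setT v ->
  measurable_fun setT (fun x : E => (v (x + z) - v x) ^+ 2).
Proof.
move=> mv; apply/measurable_funX/measurable_funB => //.
exact: (measurableT_comp mv (mshift z)).
Qed.

(** Split the increment over 2 z into two increments over z, and translate. *)
Lemma shift_energy_double v z : measurable_fun setT v ->
  (shift_energy v (z + z) <= 4%:E * shift_energy v z)%E.
Proof.
move=> mv.
pose f (x : E) : \bar R := ((v (x + z) - v x) ^+ 2)%:E.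
have mf : measurable_fun setT f by apply/measurable_EFinP; exact: mdiff.
have f0 x : (0 <= f x)%E by rewrite lee_fin sqr_ge0.
have mfz : measurable_fun setT (fun x : E => f (x + z)).
  exact: (measurableT_comp mf (mshift z)).
apply: (@le_trans _ _ (\int[mu]_x (2%:E * (f (x + z)%R + f x)))%E).
  apply: ge0_le_integral => //.
  - by move=> x _; rewrite lee_fin sqr_ge0.
  - by apply/measurable_EFinP; exact: mdiff.
  - by apply: measurable_funeM; exact: emeasurable_funD.
  - move=> x _; rewrite /f -EFinD -EFinM lee_fin addrA.
    have := sqr_ge0 (v (x + z + z) - v (x + z) - (v (x + z) - v x)).
    by lra.
rewrite ge0_integralZl_EFin//; last 2 first.
- by move=> x _; rewrite adde_ge0.
- exact: emeasurable_funD.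
rewrite ge0_integralD// (ge0_integral_rV_shift z mf f0) -/(shift_energy v z).
rewrite -[X in (_ * (X + _))%E]mul1e -[X in (_ * (_ + X))%E]mul1e.
rewrite -ge0_muleDl// -EFinD muleA -EFinM (_ : 2 * (1 + 1) = 4 :> R)//.
by ring.
Qed.

Lemma shift_energy_pow2 v z m : measurable_fun setT v ->
  (shift_energy v (2 ^+ m *: z) <= (4 ^+ m)%:E * shift_energy v z)%E.
Proof.
move=> mv; elim: m => [|m ih]; first by rewrite !expr0 scale1r mul1e.
rewrite exprS mulr_natl mulr2n scalerDl (le_trans (shift_energy_double _ mv))//.
by rewrite exprS EFinM -muleA lee_pmul2l.
Qed.

Lemma shift_energy_disjoint v z : L2 v -> (forall x, v (x + z) * v x = 0) ->
  shift_energy v z = (2 * sqnorm v)%:E.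
Proof.
move=> hv vz; have [mv _] := hv.
rewrite /shift_energy (eq_integral (fun x : E => (v (x + z) ^+ 2)%:E + (v x ^+ 2)%:E)%E).
  rewrite ge0_integralD//=.
  - rewrite (ge0_integral_rV_shift z (f := fun x : E => (v x ^+ 2)%:E)).
    + by rewrite sqnormE// -EFinD; congr (_%:E); ring.
    + exact/measurable_EFinP/measurable_funX.
    + by move=> x; rewrite lee_fin sqr_ge0.
  - by move=> x _; rewrite lee_fin sqr_ge0.
  - apply/measurable_EFinP/measurable_funX.
    exact: (measurableT_comp mv (mshift z)).
  - by move=> x _; rewrite lee_fin sqr_ge0.
  - exact/measurable_EFinP/measurable_funX.
move=> x _; rewrite -EFinD; congr (_%:E).
by rewrite sqrrB (vz x) mul0rn subr0.
Qed.

Lemma form_shift_energy v : L2 v ->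
  (\int[mu]_z ((k z)%:E * shift_energy v z) = (form k v v)%:E)%E.
Proof.
move=> hv; have [mv _] := hv; rewrite -(form_iterated k0 mk k1 kN hv).
pose F (p : E * E) : \bar R := ((v (p.1 + p.2) - v p.1) ^+ 2 * k p.2)%:E.
have madd : measurable_fun setT (fun p : E * E => p.1 + p.2).
  apply: measurable_fun_rV => i; under eq_fun do rewrite mxE.
  by apply: measurable_funD; apply: (measurableT_comp (measurable_coord i)).
have mF : measurable_fun setT F.
  apply/measurable_EFinP/measurable_funM; last exact: (measurableT_comp mk).
  apply/measurable_funX/measurable_funB; first exact: (measurableT_comp mv madd).
  exact: (measurableT_comp mv).
have F0 p : (0 <= F p)%E by rewrite lee_fin mulr_ge0// sqr_ge0.
transitivity (\int[mu]_z \int[mu]_x F (x, z))%E.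
  apply: eq_integral => z _; rewrite -ge0_integralZl_EFin//.
  - by apply: eq_integral => x _; rewrite /F/= EFinM muleC.
  - by move=> x _; rewrite lee_fin sqr_ge0.
  - by apply/measurable_EFinP; exact: mdiff.
rewrite -(fubini_tonelli F mF F0); apply: eq_integral => x _.
rewrite /fubini_F -(ge0_integral_rV_shift x
  (f := fun y : E => ((v y - v x) ^+ 2 * k (y - x))%:E)).
- by apply: eq_integral => y _; rewrite /F/= addrK (addrC x).
- apply/measurable_EFinP/measurable_funM; last exact: (measurableT_comp mk (mshift _)).
  by apply/measurable_funX/measurable_funB.
- by move=> y; rewrite lee_fin mulr_ge0// sqr_ge0.
Qed.

(** When v is supported in the cube of half-width r, the supports of v and of
    its translate by 2^m z are disjoint for z in this set. *)
Let Z (r : R) (m : nat) : set E :=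
  [set z | exists i, 2 * r < 2 ^+ m * `|z ord0 i|].

Let mZ r m : measurable (Z r m).
Proof.
rewrite (_ : Z r m = \bigcup_(i in [set: 'I_n.+1])
    (fun x : E => 2 ^+ m * `|x ord0 i|) @^-1` `]2 * r, +oo[).
  apply: fin_bigcup_measurable => // i _; rewrite -[X in measurable X]setTI.
  suff mi : measurable_fun setT (fun x : E => 2 ^+ m * `|x ord0 i|) by exact: mi.
  apply: measurable_funM => //; apply: measurableT_comp => //.
  exact: measurable_coord.
apply/seteqP; split=> z /= [i].
  by move=> iz; exists i => //; rewrite /= in_itv/= andbT.
by rewrite /= in_itv/= andbT => _ iz; exists i.
Qed.

(** These sets increase to the complement of the origin, a null set, so the
    kernel mass on them increases to 1. *)
Lemma kernel_mass_far (r : R) : 0 <= r ->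
  exists m, (0 < \int[mu]_(z in Z r m) (k z)%:E)%E.
Proof.
move=> r0; apply: contrapT => /forallNP noZ.
have Z0 m : (\int[mu]_(z in Z r m) (k z)%:E = 0)%E.
  apply/eqP; rewrite eq_le; apply/andP; split.
    by rewrite leNgt; apply/negP; exact: noZ.
  by apply: integral_ge0 => z _; rewrite lee_fin.
have ndZ : nondecreasing_seq (Z r).
  apply/nondecreasing_seqP => m; apply/subsetPset => z [i iz]; exists i.
  apply: (lt_le_trans iz); rewrite ler_wpM2r// exprS ler_peMl ?exprn_ge0//.
  by rewrite ler1n.
have mkE : measurable_fun setT (EFin \o k) by exact/measurable_EFinP.
have := @ge0_nondecreasing_set_cvg_integral _ _ _ (Z r) (EFin \o k) mu ndZ
  (mZ r) (fun i => measurable_funS measurableT (@subsetT _ _) mkE)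
  (fun i x _ => k0 x).
rewrite (_ : (fun _ => _) = cst 0%E); last by apply/funext => m; exact: Z0.
move=> /(cvg_lim (@ereal_hausdorff _)).
rewrite lim_cst// (_ : \bigcup_i Z r i = setT `\` [set 0]); last first.
  apply/seteqP; split=> [z [m _ [i iz]]|z [_ z0]].
    split=> // z0; move: iz; rewrite z0 mxE normr0 mulr0.
    by rewrite ltNge mulr_ge0.
  have /existsP[i zi] : [exists i, z ord0 i != 0].
    apply: contrapT => /negP; rewrite negb_exists => /forallP zi; apply: z0.
    by apply/rowP => i; rewrite mxE; apply/eqP; have := zi i; rewrite negbK.
  have az : 0 < `|z ord0 i| by rewrite normr_gt0.
  have [m rm] : exists m : nat, 2 * r / `|z ord0 i| < 2 ^+ m.
    exists (Num.truncn (2 * r / `|z ord0 i|)).+1.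
    rewrite (lt_le_trans (truncnS_gt _))// -natrX ler_nat ltnW//.
    exact: ltn_expl.
  by exists m => //; exists i; rewrite -ltr_pdivrMr.
rewrite -(ge0_negligible_integral _ _ _ _ (lebesgue_rV_origin R n))//.
- by rewrite k1 => /eqP; rewrite eq_sym onee_eq0.
- exact: measurable_set1_rV.
- by move=> z _; rewrite /= lee_fin.
Qed.

(** A nonlocal Poincare inequality. The constant depends on the kernel and on
    the size of the support only, which is what makes the final error bound
    independent of the mesh. *)
Theorem nonlocal_poincare (r : R) : 0 <= r -> exists2 c : R, 0 < c &
  forall v, L2 v -> (forall x, v x != 0 -> forall i, `|x ord0 i| <= r) ->
  c * sqnorm v <= form k v v.
Proof.
move=> r0; have [m] := kernel_mass_far r0.
have kfin : (\int[mu]_(z in Z r m) (k z)%:E <= 1)%E.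
  rewrite -k1; apply: ge0_subset_integral => //; first exact/measurable_EFinP.
  by move=> z _; rewrite lee_fin.
have Ifin : (\int[mu]_(z in Z r m) (k z)%:E)%E \is a fin_num.
  rewrite ge0_fin_numE; first by rewrite (le_lt_trans kfin) ?ltry.
  by apply: integral_ge0 => z _; rewrite lee_fin.
rewrite -(fineK Ifin); set I := fine _; rewrite lte_fin => I0.
exists (4 ^- m * 2 * I) => [|v hv vr].
  by rewrite !mulr_gt0// invr_gt0 exprn_gt0.
have [mv _] := hv.
rewrite -lee_fin -(form_shift_energy hv).
have mS : measurable_fun setT (fun z => ((k z)%:E * shift_energy v z)%E).
  apply: emeasurable_funM; first exact/measurable_EFinP.
  apply: (@measurable_fun_integral2 _ _ _ _ _ mu
    (fun p : E * E => ((v (p.2 + p.1) - v p.2) ^+ 2)%:E)).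
  apply/measurable_EFinP/measurable_funX/measurable_funB.
    apply: (measurableT_comp mv); apply: measurable_fun_rV => i.
    under eq_fun do rewrite mxE.
    by apply: measurable_funD; apply: (measurableT_comp (measurable_coord i)).
  exact: (measurableT_comp mv).
have S0 z : (0 <= shift_energy v z)%E.
  by apply: integral_ge0 => x _; rewrite lee_fin sqr_ge0.
apply: (@le_trans _ _ (\int[mu]_(z in Z r m) ((k z)%:E * shift_energy v z))%E);
  last first.
  apply: ge0_subset_integral => //.
  by move=> z _; rewrite mule_ge0// lee_fin.
rewrite mulrAC EFinM fineK// -ge0_integralZl//; last 3 first.
- exact/measurable_EFinP/measurable_funTS.
- by move=> z _; rewrite lee_fin.
- by rewrite lee_fin mulr_ge0 ?sqnorm_ge0// mulr_ge0// invr_ge0 exprn_ge0.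
apply: ge0_le_integral => //.
- move=> z _; rewrite mule_ge0 ?lee_fin//.
  by rewrite mulr_ge0 ?sqnorm_ge0// mulr_ge0// invr_ge0 exprn_ge0.
- by apply: measurable_funeM; exact/measurable_EFinP/measurable_funTS.
- exact: measurable_funTS.
move=> z [i iz]; rewrite muleC lee_pmul// ?lee_fin//.
  by rewrite mulr_ge0 ?sqnorm_ge0// mulr_ge0// invr_ge0 exprn_ge0.
have zz x : v (x + 2 ^+ m *: z) * v x = 0.
  apply/eqP; rewrite mulf_eq0; apply: contrapT => /negP; rewrite negb_or.
  move=> /andP[/vr/(_ i) + /vr/(_ i)]; rewrite !mxE => h1 h2.
  move: iz; rewrite ltNge => /negP; apply.
  have p0 : 0 <= 2 ^+ m :> R by rewrite exprn_ge0.
  rewrite -[X in X * _](ger0_norm p0) -normrM.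
  rewrite -(addKr (x ord0 i) (2 ^+ m * z ord0 i)).
  rewrite (le_trans (ler_normD _ _))// normrN mulr_natl mulr2n lerD//.
have := shift_energy_pow2 z m mv; rewrite (shift_energy_disjoint hv zz).
have p40 : 0 <= 4 ^- m :> R by rewrite invr_ge0 exprn_ge0.
move=> /(lee_wpmul2l (x := (4 ^- m)%:E)); rewrite lee_fin => /(_ p40).
by rewrite -EFinM muleA -EFinM mulVf ?mul1e ?mulrA// gt_eqF// exprn_gt0.
Qed.

End poincare.

(** * Projection onto finitely many vectors *)

(** A semi-inner product B on a space S of functions that are not identified
    when they agree almost everywhere, so that B may be degenerate. *)
Section projection.
Context {R : realFieldType} {U : Type} {I : eqType}.
Implicit Types (x y z u w : U -> R) (s : seq I).
Variables (S W : set (U -> R)) (B : (U -> R) -> (U -> R) -> R) (F : I -> U -> R).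

Hypothesis SL : forall x y a, S x -> S y -> S (fun t => x t + a * y t).
Hypothesis WS : W `<=` S.
Hypothesis W0 : W (fun=> 0).
Hypothesis WL : forall x y a, W x -> W y -> W (fun t => x t + a * y t).
Hypothesis BC : forall x y, B x y = B y x.
Hypothesis BL : forall x y z a, S x -> S y -> S z ->
  B (fun t => x t + a * y t) z = B x z + a * B y z.
Hypothesis B0 : forall x, S x -> 0 <= B x x.

Let BR x y z a : S x -> S y -> S z ->
  B z (fun t => x t + a * y t) = B z x + a * B z y.
Proof. by move=> Sx Sy Sz; rewrite BC BL// (BC x) (BC y). Qed.

(** The degenerate case of the Cauchy-Schwarz inequality: otherwise the square
    norm of x + t y, which is affine in t, would take negative values. *)
Lemma semi_orthogonal0 x y : S x -> S y -> B y y = 0 -> B x y = 0.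
Proof.
move=> Sx Sy yy0; apply: contrapT => /eqP xy0.
pose t := - (B x x + 1) / (2 * B x y).
have := B0 (SL t Sx Sy); rewrite BL//; last exact: SL.
rewrite !BR// (BC y) yy0.
rewrite (_ : _ + _ = -1); first by rewrite leNgt ltrN10.
by rewrite /t; field.
Qed.

(** Gram-Schmidt. The last clause, that w is orthogonal to whatever is
    orthogonal to the F i, stands for w being in their span; the induction
    applies it to the projection p of the new vector. If what remains of the new
    vector has norm 0, it is orthogonal to everything and can be ignored. *)
Lemma semi_projection s : (forall i, i \in s -> W (F i)) -> forall u, S u ->
  exists w, [/\ W w, forall i, i \in s -> B (fun t => u t + -1 * w t) (F i) = 0 &
    forall x, S x -> (forall i, i \in s -> B x (F i) = 0) -> B x w = 0].
Proof.
elim: s => [|a s ih] sW u Su.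
  exists (fun=> 0); split=> // x Sx _.
  have S0 := WS W0.
  rewrite (_ : (fun=> 0) = (fun t => x t + -1 * x t)).
    by rewrite BR// mulN1r subrr.
  by apply/funext => t; rewrite mulN1r subrr.
have sW' i : i \in s -> W (F i) by move=> si; apply: sW; rewrite inE si orbT.
have Wa : W (F a) by apply: sW; rewrite mem_head.
have Sa := WS Wa.
have [w1 [Ww1 w1s w1x]] := ih sW' u Su.
have [p [Wp ps px]] := ih sW' (F a) Sa.
have [Sw1 Sp] : S w1 /\ S p by split; exact: WS.
pose a' := fun t => F a t + -1 * p t.
have Wa' : W a' by exact: WL.
have Sa' := WS Wa'.
have BaE x : S x -> B x (F a) = B x a' + B x p.
  by move=> Sx; rewrite BR// mulN1r subrK.
have [aa0|aa0] := eqVneq (B a' a') 0.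
  exists w1; split=> // [i|x Sx xs].
    rewrite inE => /predU1P[->|]; last exact: w1s.
    have Su1 : S (fun t => u t + -1 * w1 t) by exact: SL.
    by rewrite BaE// (semi_orthogonal0 Su1 Sa' aa0) px// addr0.
  by apply: w1x => // i si; apply: xs; rewrite inE si orbT.
pose e := fun t => u t + -1 * w1 t.
have Se : S e by exact: SL.
pose c := B e a' / B a' a'.
pose w := fun t => w1 t + c * a' t.
have Ww : W w by exact: WL.
have wE : (fun t => u t + -1 * w t) = (fun t => e t + (- c) * a' t).
  by apply/funext => t; rewrite /e /w; ring.
have ws i : i \in s -> B (fun t => u t + -1 * w t) (F i) = 0.
  move=> si; have Si := WS (sW' _ si).
  by rewrite wE BL// w1s// ps// mulr0 addr0.
exists w; split=> // [i|x Sx xs].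
  rewrite inE => /predU1P[->|]; last exact: ws.
  have Sw : S (fun t => u t + -1 * w t) by apply: SL => //; exact: WS.
  rewrite BaE// px// addr0 wE BL// /c mulNr divfK// subrr//.
have xs' i : i \in s -> B x (F i) = 0.
  by move=> si; apply: xs; rewrite inE si orbT.
rewrite /w BR// w1x// add0r (_ : B x a' = 0) ?mulr0//.
have := BaE _ Sx; rewrite px// addr0 => <-.
by apply: xs; rewrite mem_head.
Qed.

End projection.

(** * Density of Lipschitz functions *)
Section density.
Context {R : realType} {d : nat}.
Local Notation E := 'rV[R]_d.
Local Notation mu := (lebesgue_rV d).
Implicit Types (f g : E -> R).
Variable Omega : set E.
Hypotheses (mO : measurable Omega) (finO : (mu Omega < +oo)%E).

Definition elipschitz g := exists2 L : R, 0 <= L &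
  forall x y, `|g x - g y| <= L * enorm (x - y).

(** Membership in the L2 closure, over Omega, of the Lipschitz functions. *)
Definition lipschitz_approx f := measurable_fun setT f /\
  forall e : R, 0 < e -> exists g, [/\ measurable_fun setT g, elipschitz g &
    (\int[mu]_(x in Omega) ((f x - g x) ^+ 2)%:E <= e%:E)%E].

Let mdiff f g : measurable_fun setT f -> measurable_fun setT g ->
  measurable_fun Omega (fun x => ((f x - g x) ^+ 2)%:E).
Proof.
move=> mf mg; apply/measurable_EFinP/measurable_funX.
by apply: measurable_funTS; exact: measurable_funB.
Qed.

(** The triangle inequality for square integrals, in the weak form that all
    closure properties below use. *)
Let le_sqr_int (h f g f' g' : E -> R) (a b : R) (s t : R) :
  measurable_fun setT f -> measurable_fun setT g ->
  measurable_fun setT f' -> measurable_fun setT g' -> measurable_fun setT h ->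
  0 <= a -> 0 <= b ->
  (forall x, 0 <= h x <= a * (f x - g x) ^+ 2 + b * (f' x - g' x) ^+ 2) ->
  (\int[mu]_(x in Omega) ((f x - g x) ^+ 2)%:E <= s%:E)%E ->
  (\int[mu]_(x in Omega) ((f' x - g' x) ^+ 2)%:E <= t%:E)%E ->
  (\int[mu]_(x in Omega) (h x)%:E <= (a * s + b * t)%:E)%E.
Proof.
move=> mf mg mf' mg' mh a0 b0 hle fs ft.
apply: (@le_trans _ _ (\int[mu]_(x in Omega) (a%:E * ((f x - g x) ^+ 2)%:E +
   b%:E * ((f' x - g' x) ^+ 2)%:E))%E).
  apply: ge0_le_integral => //.
  - by move=> x _; rewrite lee_fin; case/andP: (hle x).
  - by apply/measurable_EFinP; exact: measurable_funTS.
  - by apply: emeasurable_funD; apply: measurable_funeM; exact: mdiff.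
  - by move=> x _; rewrite -!EFinM -EFinD lee_fin; case/andP: (hle x).
rewrite ge0_integralD//; last 4 first.
- by move=> x _; rewrite mule_ge0// lee_fin// sqr_ge0.
- by apply: measurable_funeM; exact: mdiff.
- by move=> x _; rewrite mule_ge0// lee_fin// sqr_ge0.
- by apply: measurable_funeM; exact: mdiff.
rewrite !ge0_integralZl_EFin//; last 4 first.
- by move=> x _; rewrite lee_fin// sqr_ge0.
- exact: mdiff.
- by move=> x _; rewrite lee_fin// sqr_ge0.
- exact: mdiff.
by rewrite EFinD !EFinM leeD// lee_wpmul2l// lee_fin.
Qed.

Lemma lipschitz_approx_lip g : measurable_fun setT g -> elipschitz g ->
  lipschitz_approx g.
Proof.
move=> mg lg; split=> // e e0; exists g; split=> //.
rewrite integral0_eq ?lee_fin ?ltW// => x _.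
by rewrite subrr expr0n.
Qed.

Lemma lipschitz_approxD f g : lipschitz_approx f -> lipschitz_approx g ->
  lipschitz_approx (fun x => f x + g x).
Proof.
move=> [mf fe] [mg ge]; split=> [|e e0]; first exact: measurable_funD.
have e4 : 0 < e / 4 by rewrite divr_gt0.
have [f' [mf' [L L0 Lf] fi]] := fe _ e4.
have [g' [mg' [M M0 Mg] gi]] := ge _ e4.
exists (fun x => f' x + g' x); split; first exact: measurable_funD.
  exists (L + M) => [|x y]; first exact: addr_ge0.
  rewrite opprD addrACA (le_trans (ler_normD _ _))// mulrDl lerD//.
have := @le_sqr_int (fun x => (f x + g x - (f' x + g' x)) ^+ 2) f f' g g' 2 2
  _ _ mf mf' mg mg' _ _ _ _ fi gi.
rewrite (_ : 2 * (e / 4) + 2 * (e / 4) = e); last by field.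
apply=> //.
  by apply/measurable_funX/measurable_funB; exact: measurable_funD.
move=> x; rewrite sqr_ge0/=.
by have := sqr_ge0 (f x - f' x - (g x - g' x)); lra.
Qed.

Lemma lipschitz_approxZ (a : R) f : lipschitz_approx f ->
  lipschitz_approx (fun x => a * f x).
Proof.
move=> [mf fe]; split=> [|e e0]; first exact: measurable_funM.
have a1 : 0 < a ^+ 2 + 1 by rewrite ltr_wpDl// sqr_ge0.
have [f' [mf' [L L0 Lf] fi]] := fe (e / (a ^+ 2 + 1)) (divr_gt0 e0 a1).
exists (fun x => a * f' x); split; first exact: measurable_funM.
  exists (`|a| * L) => [|x y]; first exact: mulr_ge0.
  by rewrite -mulrBr normrM -mulrA ler_wpM2l.
have := @le_sqr_int (fun x => (a * f x - a * f' x) ^+ 2) f f' f f'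
  (a ^+ 2 + 1) 0 _ _ mf mf' mf mf' _ _ _ _ fi fi.
rewrite mul0r addr0 mulrCA mulfV ?gt_eqF// mulr1; apply => //.
- by apply/measurable_funX/measurable_funB; exact: measurable_funM.
- exact: ltW.
move=> x; rewrite sqr_ge0/=.
by have := sqr_ge0 (f x - f' x); lra.
Qed.

Lemma lipschitz_approx_max f g : lipschitz_approx f -> lipschitz_approx g ->
  lipschitz_approx (fun x => Num.max (f x) (g x)).
Proof.
move=> [mf fe] [mg ge]; split=> [|e e0]; first exact: measurable_maxr.
have maxD (a b a' b' M : R) : `|a - a'| <= M -> `|b - b'| <= M ->
    `|Num.max a b - Num.max a' b'| <= M.
  move=> /ler_normlP[? ?] /ler_normlP[? ?]; apply/ler_normlP.
  by rewrite /Num.max; do 2 case: ifPn; rewrite -?leNgt => ? ?; split; lra.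
have e4 : 0 < e / 2 by rewrite divr_gt0.
have [f' [mf' [L L0 Lf] fi]] := fe _ e4.
have [g' [mg' [M M0 Mg] gi]] := ge _ e4.
exists (fun x => Num.max (f' x) (g' x)); split; first exact: measurable_maxr.
  exists (L + M) => [|x y]; first exact: addr_ge0.
  apply: maxD; rewrite mulrDl.
    by rewrite (le_trans (Lf _ _))// lerDl mulr_ge0// enorm_ge0.
  by rewrite (le_trans (Mg _ _))// lerDr mulr_ge0// enorm_ge0.
have := @le_sqr_int (fun x => (Num.max (f x) (g x) - Num.max (f' x) (g' x)) ^+ 2)
  f f' g g' 1 1 _ _ mf mf' mg mg' _ _ _ _ fi gi.
rewrite (_ : 1 * (e / 2) + 1 * (e / 2) = e); last by field.
apply=> //.
  by apply/measurable_funX/measurable_funB; exact: measurable_maxr.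
move=> x; rewrite sqr_ge0/= !mul1r.
have h : `|Num.max (f x) (g x) - Num.max (f' x) (g' x)| <=
    Num.max `|f x - f' x| `|g x - g' x|.
  by apply: maxD; rewrite le_max lexx ?orbT.
rewrite -real_normK ?num_real//.
apply: (@le_trans _ _ (Num.max `|f x - f' x| `|g x - g' x| ^+ 2)).
  by rewrite ler_sqr ?nnegrE// (le_trans _ h).
by rewrite /Num.max; case: ifP => _; rewrite real_normK ?num_real//;
  rewrite ?lerDl ?lerDr sqr_ge0.
Qed.

(** The dominated convergence theorem: this is the only limit taken, for
    half-spaces, for countable unions and for simple functions. *)
Lemma lipschitz_approx_cvg f (f_ : nat -> E -> R) (G : E -> R) :
  measurable_fun setT f -> (forall n, lipschitz_approx (f_ n)) ->
  (forall x, f_ n x @[n --> \oo] --> f x) ->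
  mu.-integrable Omega (EFin \o G) ->
  (forall n x, (f x - f_ n x) ^+ 2 <= G x) ->
  lipschitz_approx f.
Proof.
move=> mf af cf iG fG; split=> // e e0.
have mfn n : measurable_fun setT (f_ n) by case: (af n).
have := @dominated_cvg _ _ _ mu Omega mO (fun n x => ((f x - f_ n x) ^+ 2)%:E)
  (cst 0%E) (EFin \o G) (fun n => mdiff mf (mfn n)).
rewrite integral_cst// mul0e => /(_ _ _ iG _).
have e4 : 0 < e / 4 by rewrite divr_gt0.
move=> cvg0; have {}cvg0 : (\int[mu]_(x in Omega) ((f x - f_ n x) ^+ 2)%:E
    @[n --> \oo] --> 0)%E.
  apply: cvg0 => //.
  - move=> x _; apply: cvg_EFin; first by apply: nearW.
    rewrite (_ : _ \o _ = (fun n => (f x - f_ n x) ^+ 2))//.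
    have -> : 0 = (f x - f x) ^+ 2 by rewrite subrr expr0n.
    apply: (@cvg_comp _ _ _ (fun n => f x - f_ n x) (fun t => t ^+ 2)).
      by apply: cvgB; [exact: cvg_cst|exact: cf].
    exact: exprn_continuous.
  - by move=> n x _; rewrite /= lee_fin ger0_norm ?sqr_ge0.
have [n _ /(_ n (leqnn n)) /= /ltW hn] : \forall n \near \oo,
    (\int[mu]_(x in Omega) ((f x - f_ n x) ^+ 2)%:E < (e / 4)%:E)%E.
  apply: (cvg0 [set y | (y < (e / 4)%:E)%E]); apply: open_nbhs_nbhs.
  by split; [exact: open_ereal_lt_ereal|rewrite /= lte_fin].
have [g [mg lg gi]] := (af n).2 _ e4.
exists g; split=> //.
have := @le_sqr_int (fun x => (f x - g x) ^+ 2) f (f_ n) (f_ n) g 2 2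
  _ _ mf (mfn n) (mfn n) mg _ _ _ _ hn gi.
rewrite (_ : 2 * (e / 4) + 2 * (e / 4) = e); last by field.
apply=> //.
  by apply/measurable_funX/measurable_funB.
move=> x; rewrite sqr_ge0/=.
by have := sqr_ge0 (f x - f_ n x - (f_ n x - g x)); lra.
Qed.

Let approx_set (A : set E) := measurable A /\ lipschitz_approx (\1_A : E -> R).

Let cst_approx (a : R) : lipschitz_approx (fun=> a).
Proof.
apply: lipschitz_approx_lip => //; exists 0 => // x y.
by rewrite subrr normr0 mul0r.
Qed.

Let approx_set0 : approx_set set0.
Proof. by split=> //; rewrite indic0; exact: cst_approx. Qed.

Let approx_setC A : approx_set A -> approx_set (~` A).
Proof.
move=> [mA aA]; split; first exact: measurableC.
have := lipschitz_approxD (cst_approx 1) (lipschitz_approxZ (-1) aA).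
congr lipschitz_approx; apply/funext => x; rewrite !indicE in_setC.
by case: (x \in A) => /=; ring.
Qed.

Let approx_setU A B : approx_set A -> approx_set B -> approx_set (A `|` B).
Proof.
move=> [mA aA] [mB aB]; split; first exact: measurableU.
have := lipschitz_approx_max aA aB.
congr lipschitz_approx; apply/funext => x; rewrite !indicE in_setU.
by case: (x \in A); case: (x \in B); rewrite /= /Num.max ?ltxx ?ltr01 ?ltr10.
Qed.

Let integrable1 : mu.-integrable Omega (EFin \o (fun=> 1)).
Proof.
apply/integrableP; split; first exact: measurable_cst.
by under eq_integral do rewrite /= normr1; rewrite integral_cst// mul1e.
Qed.

Let approx_setUs (F : nat -> set E) : (forall n, approx_set (F n)) ->
  approx_set (\bigcup_n F n).
Proof.
move=> aF; pose G n := \big[setU/set0]_(i < n) F i.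
have aG n : approx_set (G n).
  rewrite /G; elim: n => [|n ih]; first by rewrite big_ord0.
  by rewrite big_ord_recr/=; exact: approx_setU.
have mU : measurable (\bigcup_n F n).
  by apply: bigcupT_measurable => n; case: (aF n).
split=> //.
apply: (@lipschitz_approx_cvg _ (fun n => \1_(G n)) (fun=> 1)) => //.
- by move=> n; case: (aG n).
- move=> x; apply: cvg_near_cst.
  have [[n _ Fx]|nFx] := pselect ((\bigcup_n F n) x).
    exists n.+1 => // m /= nm; rewrite !indicE !mem_set//.
      by exists n.
    by rewrite /G -bigcup_mkord; exists n.
  apply: nearW => n; rewrite !indicE.
  have nG : ~ G n x.
    by rewrite /G -bigcup_mkord => -[i _ Fx]; apply: nFx; exists i.
  by rewrite (memNset nG) (memNset nFx).
Qed.

(** Indicators of half-spaces are limits of continuous ramps. *)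
Let approx_halfspace (i : 'I_d) (a : R) : approx_set [set x | a < x ord0 i].
Proof.
have mi := @measurable_coord R d i.
have mH : measurable [set x : E | a < x ord0 i].
  rewrite (_ : [set _ | _] = (fun x : E => x ord0 i) @^-1` `]a, +oo[).
    by rewrite -[X in measurable X]setTI; exact: mi.
  by apply/seteqP; split=> x /=; rewrite in_itv/= andbT.
split=> //.
pose g n (x : E) : R := Num.min 1 (Num.max 0 (n%:R * (x ord0 i - a))).
apply: (@lipschitz_approx_cvg _ g (fun=> 1)) => //.
- move=> n; apply: lipschitz_approx_lip.
    apply: measurable_minr => //; apply: measurable_maxr => //.
    by apply: measurable_funM => //; exact: measurable_funB.
  exists n%:R => // x y.
  have nxy : `|n%:R * (x ord0 i - a) - n%:R * (y ord0 i - a)| <=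
      n%:R * enorm (x - y).
    rewrite -mulrBr normrM ger0_norm// ler_wpM2l//.
    have := coord_le_enorm (x - y) i; rewrite !mxE => /(le_trans _); apply.
    by rewrite opprB addrA subrK.
  apply: le_trans nxy; rewrite /g.
  move: (n%:R * (x ord0 i - a)) (n%:R * (y ord0 i - a)) => s t.
  have := ler_norm (s - t); have := ler_norm (t - s); rewrite (distrC t).
  move: `|s - t| => m h1 h2; apply/ler_normlP; rewrite /Num.min /Num.max.
  by do 4 case: ifPn; rewrite -?leNgt => *; split; lra.
- move=> x; apply: cvg_near_cst; rewrite indicE.
  have [ax|ax] := ltP a (x ord0 i); last first.
    apply: nearW => n; rewrite memNset/=; last by rewrite ltNge ax.
    by rewrite /g max_l ?min_r// mulr_ge0_le0// subr_le0.
  have ax0 : 0 < x ord0 i - a by rewrite subr_gt0.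
  exists (Num.truncn (x ord0 i - a)^-1).+1 => // n /= nn.
  rewrite mem_set//= /g.
  have h : 1 <= n%:R * (x ord0 i - a).
    rewrite -ler_pdivrMr// div1r (le_trans (ltW (truncnS_gt _)))// ler_nat//.
  by rewrite max_r ?(le_trans ler01)// min_l.
- move=> n x; have g01 : 0 <= g n x <= 1.
    by rewrite /g le_min ler01 le_max lexx ge_min lexx.
  rewrite indicE; move: g01; move: (g n x) => t /andP[t0 t1].
  have : 0 <= t * (1 - t) by rewrite mulr_ge0// subr_ge0.
  by case: (x \in _) => /=; lra.
Qed.

(** The sets whose indicator can be approximated form a sigma-algebra that
    contains the half-spaces, hence all measurable sets. *)
Let measurable_approx A : measurable A -> approx_set A.
Proof.
apply: (@smallest_sub _ _ _ [set B | approx_set B]).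
  by split=> //= B; rewrite setTD; exact: approx_setC.
rewrite -bigcup_seq/= => B [i _ [Y mY <-]] /=; rewrite setTI.
apply: (@smallest_sub _ _ _ [set Y | approx_set ((fun x : E => x ord0 i) @^-1` Y)]) mY.
  split=> /=.
  - by rewrite preimage_set0.
  - by move=> C; rewrite setTD -preimage_setC; exact: approx_setC.
  - by move=> F aF; rewrite preimage_bigcup; apply: approx_setUs => n; exact: aF.
move=> _ [[a b] _ <-]; change (approx_set [set x : E | x ord0 i \in `]a, b]]).
have -> : [set x : E | x ord0 i \in `]a, b]] =
    ~` (~` [set x | a < x ord0 i] `|` [set x | b < x ord0 i]).
  apply/seteqP; split=> x /=; rewrite in_itv/=.
    by move=> /andP[ax xb] [//|]; rewrite ltNge xb.
  by move=> /not_orP[/contrapT -> /=]; rewrite leNgt => /negP ->.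
by apply: approx_setC; apply: approx_setU;
  [apply: approx_setC|]; exact: approx_halfspace.
Qed.

Import HBNNSimple.

Let approx_nnsfun (h : {nnsfun E >-> R}) : lipschitz_approx h.
Proof.
rewrite (_ : (h : E -> R) = fun x =>
    \sum_(y <- fset_set (range h)) y * \1_(h @^-1` [set y]) x); last first.
  by apply/funext => x; rewrite fimfunE fsbig_finite.
elim: (enum_fset (fset_set (range h))) => [|y s ih].
  rewrite (_ : (fun _ => _) = fun=> 0); first exact: cst_approx.
  by apply/funext => x; rewrite big_nil.
rewrite (_ : (fun _ => _) = fun x => y * \1_(h @^-1` [set y]) x +
    \sum_(z <- s) z * \1_(h @^-1` [set z]) x); last first.
  by apply/funext => x; rewrite big_cons.
apply: (lipschitz_approxD _ ih); apply: lipschitz_approxZ.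
by apply: (measurable_approx _).2.
Qed.

Let approx_ge0 f : (forall x, 0 <= f x) -> measurable_fun setT f ->
  mu.-integrable Omega (fun x => (f x ^+ 2)%:E) -> lipschitz_approx f.
Proof.
move=> f0 mf if2.
have mfE : measurable_fun setT (EFin \o f) by exact/measurable_EFinP.
pose f_ := nnsfun_approx measurableT mfE.
have cf x : f_ n x @[n --> \oo] --> f x.
  have := @cvg_nnsfun_approx _ _ _ setT measurableT (EFin \o f) mfE
    (fun x _ => f0 x) x I.
  by move=> /fine_cvgP[].
apply: (lipschitz_approx_cvg mf (fun n => approx_nnsfun (f_ n)) cf if2) => n x.
have fnx : f_ n x <= f x.
  have ndf : nondecreasing_seq (fun n => f_ n x).
    by move=> p q pq; exact/lefP/nd_nnsfun_approx.
  have := nondecreasing_cvgn_le ndf (cvgP _ (cf x)) n.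
  by rewrite (cvg_lim _ (cf x)).
have fn0 : 0 <= f_ n x by exact: fun_ge0.
by move: fnx fn0; move: (f_ n x) (f x) => s t ? ?; nra.
Qed.

(** A function is the difference of its positive and negative parts, each of
    which is an increasing limit of simple functions. *)
Theorem lipschitz_dense f : measurable_fun setT f ->
  mu.-integrable Omega (fun x => (f x ^+ 2)%:E) -> lipschitz_approx f.
Proof.
move=> mf if2.
have sub g : measurable_fun setT g -> (forall x, `|g x| <= `|f x|) ->
    mu.-integrable Omega (fun x => (g x ^+ 2)%:E).
  move=> mg gf; apply: le_integrable if2 => //.
    by apply/measurable_EFinP/measurable_funX/measurable_funTS.
  by move=> x _; rewrite !abse_EFin lee_fin !normrX lerXn2r ?nnegrE.
have mp : measurable_fun setT (fun x => Num.max (f x) 0) by exact: measurable_maxr.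
have mn : measurable_fun setT (fun x => Num.max (- f x) 0).
  by apply: measurable_maxr => //; exact: measurableT_comp.
have ap : lipschitz_approx (fun x => Num.max (f x) 0).
  apply: approx_ge0 => //; first by move=> x; rewrite le_max lexx orbT.
  by apply: sub => // x; rewrite /Num.max; case: ifP => // _; rewrite normr0.
have an : lipschitz_approx (fun x => Num.max (- f x) 0).
  apply: approx_ge0 => //; first by move=> x; rewrite le_max lexx orbT.
  by apply: sub => // x; rewrite /Num.max; case: ifP => // _; rewrite ?normr0// normrN.
have := lipschitz_approxD ap (lipschitz_approxZ (-1) an).
congr lipschitz_approx; apply/funext => x; rewrite /Num.max oppr_lt0.
by case: ltgtP => h; lra.
Qed.

End density.

(** * Finite elements *)
Lemma subspace_continuous_measurable_rV (R : realType) d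
    (A : set 'rV[R]_d) (f : 'rV[R]_d -> R) :
  measurable A -> {within A, continuous f} -> measurable_fun A f.
Proof.
move=> mA /continuousP cf; apply: (measurability _ (RGenOpens.measurableE R)).
move=> _ [_ [a [b ->] <-]].
have /open_subspaceP[V oV VA] : open (f @^-1` `]a, b[ : set (subspace A)).
  exact/cf/interval_open.
rewrite setIC -VA; apply: measurableI => //; exact: open_measurable_rV.
Qed.

Section hull_facts.
Context {R : realType} {d : nat}.
Local Notation E := 'rV[R]_d.
Implicit Types (K : {fset E}).

Lemma sum_delta (V : lmodType R) K (z : E) (F : E -> V) : z \in K ->
  \sum_(y <- K) (y == z)%:R *: F y = F z.
Proof.
move=> zK; rewrite (bigD1_seq z)//=; [|exact: fset_uniq].
rewrite eqxx scale1r big1 ?addr0// => y /negPf ->.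
by rewrite scale0r.
Qed.

Lemma hull_vertex K z : z \in K -> hull K z.
Proof.
move=> zK; exists (fun y => (y == z)%:R); split=> [y _||].
- by rewrite ler0n.
- rewrite (bigD1_seq z)//=.
  by rewrite eqxx big1 ?addr0// => y /negPf ->.
- by rewrite (sum_delta id).
Qed.

Lemma affine_hull K f (w : E -> R) : affine_on (hull K) f ->
  \sum_(z <- K) w z = 1 -> hull K (\sum_(z <- K) w z *: z) ->
  f (\sum_(z <- K) w z *: z) = \sum_(z <- K) w z * f z.
Proof.
move=> [a [c fE]] w1 hx; rewrite fE//.
rewrite [RHS](_ : _ = \sum_(z <- K) (w z * dotp a z + w z * c)); last first.
  rewrite !big_seq; apply: eq_bigr => z zK.
  by rewrite fE ?mulrDr//; exact: hull_vertex.
rewrite big_split/= -mulr_suml w1 mul1r; congr (_ + _).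
rewrite /dotp; under [RHS]eq_bigr do rewrite mulr_sumr.
rewrite exchange_big/=; apply: eq_bigr => i _.
by rewrite summxE mulr_sumr; apply: eq_bigr => z _; rewrite mxE mulrCA.
Qed.

Lemma le_ediam_hull K x y : hull K x -> hull K y ->
  enorm (x - y) <= ediam (hull K).
Proof.
move=> hx hy; apply: ub_le_sup; last by exists (x, y).
pose M i : R := \sum_(z <- K) `|z ord0 i|.
have M0 i : 0 <= M i by exact: sumr_ge0.
have hM u i : hull K u -> `|u ord0 i| <= M i.
  move=> [w [w0 w1 ->]]; rewrite summxE -[leRHS]mul1r -w1 mulr_suml.
  rewrite (le_trans (ler_norm_sum _ _ _))// !big_seq; apply: ler_sum => z zK.
  rewrite mxE normrM ger0_norm ?w0// ler_wpM2l ?w0//.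
  by rewrite /M (bigD1_seq z)//= lerDl sumr_ge0.
exists (\sum_(i < d) (M i + M i)) => _ [[u v] [/= hu hv] <-].
rewrite (le_trans (enorm_le_sum _))//; apply: ler_sum => i _.
rewrite !mxE (le_trans (ler_normB _ _))// lerD//; exact: hM.
Qed.

End hull_facts.

Section finite_elements.
Context {R : realType} {d : nat}.
Local Notation E := 'rV[R]_d.
Variables (T : mesh R d) (Omega : set E) (phi : E -> E -> R).
Hypothesis phiP : nodal_basis T phi.
Local Notation Oh := (discrete_domain T Omega).

Let comb (c : E -> R) x := \sum_(z <- nodes T | `[< Oh z >])
  c z * (phi z \_ Oh) x.

Lemma mem_submesh K : K \in submesh T Omega ->
  K \in T /\ hull K `<=` closure Omega.
Proof. by rewrite !inE/= => /andP[KT /asboolP]. Qed.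

Lemma submesh_vertex K z : K \in submesh T Omega -> z \in K ->
  z \in nodes T /\ Oh z.
Proof.
move=> KS zK; have [KT _] := mem_submesh KS; split.
  by apply/bigfcupP; exists K => //; rewrite KT.
by exists K => //; exact: hull_vertex.
Qed.

(** On an element, every basis function is the barycentric interpolant of its
    nodal values, which are 0 or 1. *)
Lemma nodal_combination K (w c : E -> R) : K \in submesh T Omega ->
  \sum_(z <- K) w z = 1 -> hull K (\sum_(z <- K) w z *: z) ->
  comb c (\sum_(z <- K) w z *: z) = \sum_(z <- K) w z * c z.
Proof.
move=> KS w1 hx; set x := \sum_(z <- K) _ in hx *.
have Ohx : Oh x by exists K.
have [KT _] := mem_submesh KS.
transitivity (\sum_(z <- nodes T | `[< Oh z >])
    \sum_(y <- K) w y * (c z * (y == z)%:R)).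
  rewrite /comb big_seq_cond [RHS]big_seq_cond; apply: eq_bigr => z /andP[zT _].
  have [_ /(_ _ KT) aff phin] := phiP zT.
  rewrite patchE mem_set// /x affine_hull// mulr_sumr.
  rewrite !big_seq; apply: eq_bigr => y yK; have [yT _] := submesh_vertex KS yK.
  by rewrite mulrCA phin.
rewrite exchange_big/= !big_seq; apply: eq_bigr => y yK.
have [yT Oy] := submesh_vertex KS yK.
rewrite -mulr_sumr; congr (_ * _).
rewrite big_mkcond/= (bigD1_seq y)//=; [|exact: fset_uniq].
rewrite ifT ?eqxx ?mulr1; last exact/asboolP.
rewrite big1 ?addr0// => z /negPf zy.
by rewrite eq_sym zy mulr0 if_same.
Qed.

Lemma nodal_combination_bounded c x : `|comb c x| <= \sum_(z <- nodes T) `|c z|.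
Proof.
set S := \sum_(z <- nodes T) _; have S0 : 0 <= S by exact: sumr_ge0.
have [Ox|nOx] := pselect (Oh x); last first.
  rewrite /comb big1 ?normr0// => z _.
  by rewrite patchE memNset// mulr0.
have [K KS hx] := Ox; have [w [w0 w1 xE]] := hx.
rewrite xE nodal_combination -?xE// (le_trans (ler_norm_sum _ _ _))//.
rewrite -[leRHS]mul1r -w1 mulr_suml !big_seq; apply: ler_sum => z zK.
rewrite normrM ger0_norm ?w0// ler_wpM2l ?w0//.
have [zT _] := submesh_vertex KS zK.
by rewrite /S (bigD1_seq z)//= lerDl sumr_ge0.
Qed.

(** At x, the interpolant is a convex combination of the values of g at the
    vertices of an element containing x, all within the mesh size of x. *)
Lemma nodal_interpolation (g : E -> R) (L : R) x : 0 <= L ->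
  (forall y z, `|g y - g z| <= L * enorm (y - z)) -> Oh x ->
  `|g x - comb g x| <= L * mesh_size T.
Proof.
move=> L0 gL [K KS hx]; have [w [w0 w1 xE]] := hx.
have [KT _] := mem_submesh KS.
rewrite [in comb g x]xE nodal_combination -?xE//.
have -> : g x = \sum_(z <- K) w z * g x by rewrite -mulr_suml w1 mul1r.
rewrite -sumrB -[leRHS]mul1r -w1 mulr_suml (le_trans (ler_norm_sum _ _ _))//.
rewrite !big_seq; apply: ler_sum => z zK.
rewrite -mulrBr normrM ger0_norm ?w0// ler_wpM2l ?w0//.
rewrite (le_trans (gL _ _))// ler_wpM2l// (le_trans (le_ediam_hull hx (hull_vertex zK)))//.
exact: (@le_bigmax_seq _ R _ T 0 K xpredT (fun K => ediam (hull K)) KT).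
Qed.

Lemma measurable_nodal_combination c : closed Oh -> measurable_fun setT (comb c).
Proof.
move=> cO; have mO := closed_measurable_rV cO.
have OT : Oh `<=` region T.
  by move=> x [K /mem_submesh[KT _] hx]; exists K.
rewrite (_ : comb c = fun x => \sum_(z <- nodes T)
   (if z \in nodes T then if `[< Oh z >] then c z * (phi z \_ Oh) x else 0 else 0)).
  apply: measurable_sum => z; case: (boolP (z \in nodes T)) => // zT.
  case: (`[< Oh z >]) => //.
  apply: measurable_funM => //.
  apply: (proj1 (measurable_restrictT (phi z) mO)).
  apply: subspace_continuous_measurable_rV => //.
  by have [+ _ _] := phiP zT; exact: continuous_subspaceW.
apply/funext => x; rewrite /comb big_mkcond/= !big_seq.
by apply: eq_bigr => z ->.
Qed.

End finite_elements.

(** * Reduction to functions supported in Omega *)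

Section L2_restrictions.
Context {R : realType} {d : nat}.
Local Notation E := 'rV[R]_d.
Local Notation mu := (lebesgue_rV d).

Lemma L2normE (A : set E) (f : E -> R) :
  L2norm A f = ((\int[mu]_x (((f \_ A) x) ^+ 2)%:E) `^ 2^-1)%E.
Proof.
rewrite /L2norm unlock; congr (_ `^ _)%E; apply: eq_integral => x _.
by rewrite restrict_EFin /= powR_mulrn// real_normK// num_real.
Qed.

Lemma L2norm_sqnorm (A : set E) (f : E -> R) : L2 (f \_ A) ->
  L2norm A f = (Num.sqrt (sqnorm (f \_ A)))%:E.
Proof.
by move=> h; rewrite L2normE sqnormE// poweR_EFin powR12_sqrt// sqnorm_ge0.
Qed.

Lemma square_integrable_L2 (D A : set E) (f : E -> R) : measurable D -> measurable A ->
  A `<=` D -> square_integrable D f -> L2 (f \_ A).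
Proof.
move=> mD mA AD [mf fD].
have mfA : measurable_fun setT (f \_ A).
  by apply: (proj1 (measurable_restrictT f mA)); exact: measurable_funS mf.
have mfD : measurable_fun setT (f \_ D) by exact: (proj1 (measurable_restrictT f mD)).
split=> //.
have iD : mu.-integrable setT (fun x => ((f \_ D) x ^+ 2)%:E).
  apply/integrableP; split; first exact/measurable_EFinP/measurable_funX.
  move: fD; rewrite L2normE.
  rewrite [X in (X < +oo)%E -> _]/=.
  under [X in _ -> (X < _)%E]eq_integral do rewrite gee0_abs ?lee_fin ?sqr_ge0//.
  by apply: contraTT; rewrite -!leNgt !leye_eq => /eqP ->; rewrite poweRyr.
apply: le_integrable iD => //; first exact/measurable_EFinP/measurable_funX.
move=> x _ /=; rewrite lee_fin !ger0_norm ?sqr_ge0// !patchE.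
case: ifPn => [/set_mem/AD xD|_]; first by rewrite mem_set.
by rewrite expr0n sqr_ge0.
Qed.

Lemma bounded_L2 (A : set E) (f : E -> R) (M : R) : measurable A -> (mu A < +oo)%E ->
  measurable_fun setT f -> (forall x, `|f x| <= M) -> L2 (f \_ A).
Proof.
move=> mA finA mf fM.
have mfA : measurable_fun setT (f \_ A).
  by apply: (proj1 (measurable_restrictT f mA)); exact: measurable_funTS.
split=> //; apply/integrableP; split; first exact/measurable_EFinP/measurable_funX.
apply: (@le_lt_trans _ _ (\int[mu]_(x in A) (M ^+ 2)%:E)%E); last first.
  by rewrite integral_cst// lte_mul_pinfty// lee_fin sqr_ge0.
rewrite [leRHS]integral_mkcond; apply: ge0_le_integral => //.
- by apply: measurableT_comp => //; exact/measurable_EFinP/measurable_funX.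
- exact: (proj1 (measurable_restrictT (cst (M ^+ 2)%:E) mA)).
- move=> x _; rewrite /= ger0_norm ?sqr_ge0// !patchE; case: ifPn => _.
    rewrite lee_fin -real_normK ?num_real// ler_sqr ?nnegrE//.
    by rewrite (le_trans _ (fM x)).
  by rewrite expr0n.
Qed.

End L2_restrictions.

Section nonlocal_on_domain.
Context {R : realType} {d : nat}.
Local Notation E := 'rV[R]_d.
Local Notation mu := (lebesgue_rV d).
Variables (k : E -> R) (Omega D : set E).
Hypotheses (k0 : forall z, 0 <= k z) (mk : measurable_fun setT k).
Hypothesis k1 : (\int[mu]_z (k z)%:E = 1)%E.
Hypothesis kN : forall z, k (- z) = k z.
Hypotheses (mO : measurable Omega) (mD : measurable D) (OD : Omega `<=` D).
Hypothesis kD : forall x y, Omega x -> ~ D y -> k (y - x) = 0.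
Let gamma x y := k (y - x).
Implicit Types (v w : E -> R) (x y : E).

Let mkx x : measurable_fun setT (fun y => gamma x y).
Proof.
apply: (measurableT_comp mk) => /=.
by have := measurable_rV_affine 1 (- x); under eq_fun do rewrite scale1r.
Qed.

Let mrestr v : measurable_fun setT v -> measurable_fun setT (v \_ Omega).
Proof.
by move=> mv; apply: (proj1 (measurable_restrictT v mO)); exact: measurable_funTS.
Qed.

(** From a point of Omega the kernel reaches D only, and v vanishes almost
    everywhere on the part of D outside Omega. The values of v outside D, where
    it need not even be measurable, are multiplied by 0. *)
Lemma nonlocal_op_restrict v x : measurable_fun D v ->
  {ae mu, forall y, D y -> ~ Omega y -> v y = 0} -> Omega x ->
  nonlocal_op gamma v x = nonlocal_op gamma (v \_ Omega) x.
Proof.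
move=> mv v0 Ox.
have mvD : measurable_fun setT (v \_ D) by exact: (proj1 (measurable_restrictT v mD)).
have vx : (v \_ D) x = v x by rewrite patchE mem_set//; exact: OD.
have vx' : (v \_ Omega) x = v x by rewrite patchE mem_set.
have mvO : measurable_fun setT (v \_ Omega).
  by apply: (proj1 (measurable_restrictT v mO)); exact: measurable_funS mv.
transitivity (nonlocal_op gamma (v \_ D) x).
  apply: eq_Rintegral => y _; rewrite vx patchE.
  case: ifPn => // /negP yD; rewrite /gamma kD ?mulr0// => Dy.
  by apply: yD; rewrite inE.
rewrite /nonlocal_op /Rintegral; congr fine; apply: ae_eq_integral => //.
- apply/measurable_EFinP/measurable_funM => //; exact: measurable_funB.
- apply/measurable_EFinP/measurable_funM => //; exact: measurable_funB.
apply: filterS v0 => y v0 _; rewrite vx vx'; congr ((_ - _) * _)%:E.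
rewrite !patchE; case: (pselect (Omega y)) => Oy.
  by rewrite !mem_set//; exact: OD.
rewrite (memNset Oy); case: ifPn => // /set_mem Dy; exact: v0.
Qed.

Hypothesis Onull : mu (closure Omega `\` Omega) = 0%E.

Let ae_closure (P : E -> Prop) : (forall x, Omega x -> P x) ->
  (forall x, ~ closure Omega x -> P x) -> {ae mu, forall x, P x}.
Proof.
move=> PO PC; exists (closure Omega `\` Omega); split=> //.
  apply: measurableD => //.
  by apply: closed_measurable_rV; exact: closed_closure.
move=> x /= nPx; split; first by apply: contrapT => /PC.
by move/PO.
Qed.

Lemma ae_restrict v : (forall x, ~ closure Omega x -> v x = 0) ->
  {ae mu, forall x, v x = (v \_ Omega) x}.
Proof.
move=> v0; apply: ae_closure => x Ox; first by rewrite patchE mem_set.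
rewrite v0// patchE memNset// => /subset_closure; exact.
Qed.

(** Off D x D the integrand vanishes for a function supported in Omega: one of
    the two points would be in Omega and the other out of reach. So integrating
    over D or over the whole space makes no difference. *)
Lemma energy_norm_restrict v : measurable_fun setT v ->
  (forall x, ~ closure Omega x -> v x = 0) -> L2 (v \_ Omega) ->
  energy_norm D gamma v =
  (Num.sqrt (form k (v \_ Omega) (v \_ Omega)))%:E.
Proof.
move=> mv v0 hv; have mv' := mrestr mv.
pose f w x y : \bar R := ((w y - w x) ^+ 2 * gamma x y)%:E.
have f0 w x y : (0 <= f w x y)%E by rewrite lee_fin; apply: mulr_ge0; [exact: sqr_ge0|exact: k0].
have mf w x : measurable_fun setT w -> measurable_fun setT (f w x).
  move=> mw; apply/measurable_EFinP/measurable_funM => //.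
  by apply: measurable_funX; exact: measurable_funB.
have mf2 w : measurable_fun setT w -> measurable_fun setT (fun p => f w p.1 p.2).
  move=> mw; apply/measurable_EFinP/measurable_funM; last exact: measurable_kernel.
  by apply/measurable_funX/measurable_funB; apply: (measurableT_comp mw).
have vE := ae_restrict v0.
have off x y : (v \_ Omega) x != 0 \/ (v \_ Omega) y != 0 -> ~ (D x /\ D y) ->
    k (y - x) = 0.
  have vO z : (v \_ Omega) z != 0 -> Omega z.
    by rewrite patchE; case: ifPn => [/set_mem//|_]; rewrite eqxx.
  move=> [/vO Ox|/vO Oy] nD.
    by apply: kD => // Dy; apply: nD; split=> //; exact: OD.
  by rewrite -kN opprB; apply: kD => // Dx; apply: nD; split=> //; exact: OD.
have f'0 x y : ~ (D x /\ D y) -> f (v \_ Omega) x y = 0%E.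
  move=> nD; rewrite /f /gamma.
  have [vx|vx] := eqVneq ((v \_ Omega) x) 0; last first.
    by rewrite off ?mulr0//; left.
  have [vy|vy] := eqVneq ((v \_ Omega) y) 0; last first.
    by rewrite off ?mulr0//; right.
  by rewrite vx vy subrr expr0n mul0r.
rewrite /energy_norm (_ : integral _ _ _ = (form k (v \_ Omega) (v \_ Omega))%:E).
  by rewrite poweR_EFin powR12_sqrt// form_ge0.
rewrite -(form_iterated k0 mk k1 kN hv).
transitivity (\int[mu]_(x in D) \int[mu]_y f (v \_ Omega) x y)%E; last first.
  rewrite integral_mkcond; apply: eq_integral => x _.
  rewrite patchE; case: ifPn => // /negP nDx.
  apply/esym/integral0_eq => y _; apply: f'0 => -[Dx _]; apply: nDx.
  by rewrite inE.
apply: ge0_ae_eq_integral => //.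
- apply: measurable_funTS.
  rewrite (_ : (fun _ => _) = fun x => \int[mu]_y
      ((fun p : E * E => f v p.1 p.2) \_ (setT `*` D)) (x, y))%E.
    apply: (@measurable_fun_integral2 _ _ _ _ _ mu).
    apply: (proj1 (measurable_restrictT _ _)); first exact: measurableX.
    by apply: measurable_funTS; exact: mf2.
  apply/funext => x; rewrite integral_mkcond; apply: eq_integral => y _.
  by rewrite !patchE in_setX in_setT.
- apply: measurable_funTS.
  exact: (@measurable_fun_integral2 _ _ _ _ _ mu (fun p => f (v \_ Omega) p.1 p.2) (mf2 _ mv')).
- by move=> x _; apply: integral_ge0 => y _; exact: (f0 v).
- by move=> x _; apply: integral_ge0 => y _; exact: f0.
apply: filterS vE => x vx Dx.
transitivity (\int[mu]_(y in D) f (v \_ Omega) x y)%E.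
  apply: ge0_ae_eq_integral => //.
  - by apply: measurable_funTS; exact: mf.
  - by apply: measurable_funTS; exact: mf.
  - by move=> y Dy; exact: (f0 v).
  by have := ae_restrict v0; apply: filterS => y vy _; rewrite /f vx vy.
rewrite integral_mkcond; apply: eq_integral => y _.
rewrite patchE; case: ifPn => // /negP nDy.
by rewrite f'0// => -[_ Dy]; apply: nDy; rewrite inE.
Qed.

Lemma L2norm_closure v : measurable_fun D v -> closure Omega `<=` D ->
  L2 (v \_ Omega) ->
  L2norm (closure Omega) v = (Num.sqrt (sqnorm (v \_ Omega)))%:E.
Proof.
move=> mv CD hv; have mC : measurable (closure Omega).
  by apply: closed_measurable_rV; exact: closed_closure.
have mvC : measurable_fun setT (v \_ (closure Omega)).
  by apply: (proj1 (measurable_restrictT v mC)); exact: measurable_funS mv.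
rewrite -L2norm_sqnorm// !L2normE; congr (_ `^ _)%E.
apply: ge0_ae_eq_integral => //.
- exact/measurable_EFinP/measurable_funX.
- by apply/measurable_EFinP/measurable_funX; case: hv.
- by move=> x _; rewrite lee_fin sqr_ge0.
- by move=> x _; rewrite lee_fin sqr_ge0.
apply: ae_closure => x Ox _; congr (_ ^+ 2)%:E; rewrite !patchE.
  by rewrite !mem_set//; exact: subset_closure.
by rewrite !memNset// => /subset_closure.
Qed.

(** Both sides of the discrete equation are turned into integrals over the
    whole space of functions supported in Omega, and so is the strong equation
    for u once multiplied by w; then the Green identity applies to u and u_h. *)
Lemma galerkin_orthogonality (u uh w b : E -> R) :
  measurable_fun D u -> {ae mu, forall y, D y -> ~ Omega y -> u y = 0} ->
  L2 (u \_ Omega) -> L2 (b \_ Omega) ->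
  measurable_fun setT uh -> (forall x, ~ closure Omega x -> uh x = 0) ->
  L2 (uh \_ Omega) ->
  measurable_fun setT w -> (forall x, ~ closure Omega x -> w x = 0) ->
  L2 (w \_ Omega) ->
  {ae mu, forall x, Omega x -> - nonlocal_op gamma u x = b x} ->
  - (\int[mu]_(x in closure Omega) (nonlocal_op gamma uh x * w x)) =
    \int[mu]_(x in closure Omega) ((b \_ Omega) x * w x) ->
  form k (fun x => (u \_ Omega) x - (uh \_ Omega) x) (w \_ Omega) = 0.
Proof.
move=> mu_ u0 hu hb muh uh0 huh mw w0 hw Lu Luh.
have mC : measurable (closure Omega).
  by apply: closed_measurable_rV; exact: closed_closure.
have [mu' _] := hu; have [muh' _] := huh; have [mw' _] := hw; have [mb' _] := hb.
have [iu Fu] := form_nonlocal_op k0 mk k1 kN hu hw.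
have [iuh Fuh] := form_nonlocal_op k0 mk k1 kN huh hw.
rewrite formBl// Fu Fuh -mulrBr; apply/eqP; rewrite mulf_eq0; apply/orP; right.
rewrite subr_eq0; apply/eqP.
have bE : \int[mu]_(x in closure Omega) ((b \_ Omega) x * w x) =
    \int[mu]_x ((b \_ Omega) x * (w \_ Omega) x).
  rewrite Rintegral_mkcond; apply: eq_Rintegral => x _; rewrite !patchE.
  have [Ox|nOx] := pselect (Omega x).
    by rewrite !mem_set//; exact: subset_closure.
  by rewrite (memNset nOx) !mul0r; case: ifP.
have uhE : \int[mu]_(x in closure Omega) (nonlocal_op gamma uh x * w x) =
    \int[mu]_x (nonlocal_op gamma (uh \_ Omega) x * (w \_ Omega) x).
  rewrite Rintegral_mkcond /Rintegral; congr fine; apply: ae_eq_integral => //.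
  - apply/measurable_EFinP; apply: (proj1 (measurable_restrictT _ mC)).
    by apply: measurable_funTS; apply: measurable_funM => //;
      exact: measurable_nonlocal_op.
  - exact: measurable_int iuh.
  have uh0' : {ae mu, forall y, D y -> ~ Omega y -> uh y = 0}.
    have := ae_restrict uh0; apply: filterS => y -> _ nOy.
    by rewrite patchE memNset.
  apply: ae_closure => x Ox _; congr (_%:E); rewrite !patchE.
    rewrite !mem_set//; last exact: subset_closure.
    by rewrite -nonlocal_op_restrict//; exact: measurable_funTS.
  rewrite !memNset ?mulr0// => /subset_closure; exact: Ox.
have uE : \int[mu]_x (nonlocal_op gamma (u \_ Omega) x * (w \_ Omega) x) =
    \int[mu]_x (-1 * ((b \_ Omega) x * (w \_ Omega) x)).
  rewrite /Rintegral; congr fine; apply: ae_eq_integral => //.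
  - exact: measurable_int iu.
  - by apply/measurable_EFinP; do 2 apply: measurable_funM => //.
  apply: filterS Lu => x Lu _; congr (_%:E).
  have [Ox|nOx] := pselect (Omega x).
    rewrite -nonlocal_op_restrict// [(b \_ _) x]patchE mem_set// -Lu//.
    by rewrite mulN1r mulNr opprK.
  by rewrite !patchE (memNset nOx) !mulr0.
rewrite -/gamma uE -uhE RintegralZl//; last exact: L2_mul.
by rewrite -bE -Luh mulN1r opprK.
Qed.

End nonlocal_on_domain.

(** * The discrete space *)
Lemma lincomb_closed (R : pzRingType) (U : Type) (I : eqType)
    (P : set (U -> R)) (s : seq I) (F : I -> U -> R) (c : I -> R) :
  P (fun=> 0) -> (forall x y a, P x -> P y -> P (fun t => x t + a * y t)) ->
  (forall i, i \in s -> P (F i)) -> P (fun t => \sum_(i <- s) c i * F i t).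
Proof.
move=> P0 PL; elim: s => [|i s ih] PF.
  by rewrite (_ : (fun _ => _) = (fun=> 0)) //; apply/funext => x; rewrite big_nil.
rewrite (_ : (fun _ => _) = (fun x => \sum_(j <- s) c j * F j x + c i * F i x)).
  apply: PL; last by apply: PF; rewrite mem_head.
  by apply: ih => j js; apply: PF; rewrite inE js orbT.
by apply/funext => x; rewrite big_cons addrC.
Qed.

(** The minimizer is the orthogonal projection of u. *)
Lemma least_squares (R : realType) d (I : eqType) (s : seq I)
    (F : I -> 'rV[R]_d -> R) (u : 'rV[R]_d -> R) :
  uniq s -> (forall i, i \in s -> L2 (F i)) -> L2 u ->
  exists c : I -> R, forall c' : I -> R,
    sqnorm (fun x => u x - \sum_(i <- s) c i * F i x) <=
    sqnorm (fun x => u x - \sum_(i <- s) c' i * F i x).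
Proof.
move=> us LF Lu.
pose S : set ('rV[R]_d -> R) := L2.
pose comb (c : I -> R) x := \sum_(i <- s) c i * F i x.
pose W : set ('rV[R]_d -> R) := [set w | exists c, w = comb c].
pose B (v w : 'rV[R]_d -> R) := \int[lebesgue_rV d]_x (v x * w x).
have SL x y a : S x -> S y -> S (fun t => x t + a * y t).
  by move=> Sx Sy; apply: L2D => //; exact: L2Z.
have BC x y : B x y = B y x by apply: eq_Rintegral => t _; rewrite mulrC.
have BL x y z a : S x -> S y -> S z ->
    B (fun t => x t + a * y t) z = B x z + a * B y z.
  move=> Sx Sy Sz; rewrite /B -RintegralZl//; last exact: L2_mul.
  rewrite -RintegralD//; [|exact: L2_mul|].
    by apply: eq_Rintegral => t _; ring.
  have := integrableZl measurableT a (L2_mul Sy Sz).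
  by apply: eq_integrable => // t _ /=; rewrite -EFinM.
have BE v : B v v = sqnorm v by apply: eq_Rintegral => t _; rewrite expr2.
have B0 x : S x -> 0 <= B x x by move=> _; rewrite BE sqnorm_ge0.
have B0E e : B (fun=> 0) e = 0.
  transitivity (\int[lebesgue_rV d]_x (0 * (u x ^+ 2))).
    by apply: eq_Rintegral => t _; rewrite !mul0r.
  by rewrite RintegralZl ?mul0r//; case: Lu.
have S0 : S (fun=> 0).
  have := L2B Lu Lu; congr L2; apply/funext => x; exact: subrr.
have WS : W `<=` S.
  by move=> _ [c ->]; exact: lincomb_closed.
have W0 : W (fun=> 0).
  by exists (fun=> 0); apply/funext => x; rewrite /comb big1// => i _; rewrite mul0r.
have WL x y a : W x -> W y -> W (fun t => x t + a * y t).
  move=> [c ->] [c' ->]; exists (fun i => c i + a * c' i); apply/funext => t.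
  rewrite /comb mulr_sumr -big_split/=; apply: eq_bigr => i _; ring.
have WF i : i \in s -> W (F i).
  move=> si; exists (fun j => (j == i)%:R); apply/funext => x.
  rewrite /comb (bigD1_seq i)//= eqxx mul1r big1 ?addr0// => j /negPf ->.
  by rewrite mul0r.
have [w [Ww wF _]] := semi_projection SL WS W0 WL BC BL B0 WF Lu.
have [c wE] := Ww; exists c => c'.
pose e t := u t + -1 * w t.
have Se : S e by apply: SL => //; exact: WS.
have eW v : W v -> B e v = 0.
  move=> [c1 ->].
  apply: (proj2 (lincomb_closed (P := [set v | S v /\ B e v = 0]) c1 _ _ _)).
  - by split=> //; rewrite BC B0E.
  - move=> x y a [Sx ex] [Sy ey]; split; first exact: SL.
    by rewrite BC BL// !(BC _ e) ex ey mulr0 addr0.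
  - by move=> i si; split; [exact: LF|exact: wF].
have -> : (fun x => u x - \sum_(i <- s) c i * F i x) = e.
  by apply/funext => x; rewrite /e wE mulN1r.
pose g t := w t + -1 * comb c' t.
have Wg : W g by apply: WL => //; exists c'.
have Sg := WS _ Wg.
rewrite (_ : (fun x => u x - _) = (fun t => e t + 1 * g t)); last first.
  by apply/funext => t; rewrite /e /g /comb; ring.
have Seg : S (fun t => e t + 1 * g t) by exact: SL.
pose eg t := e t + 1 * g t; rewrite -!BE -/eg (BL _ _ _ 1 Se Sg Seg) -/eg.
rewrite (BC e eg) (BL _ _ _ 1 Se Sg Se) (BC g eg) (BL _ _ _ 1 Se Sg Sg).
rewrite (BC g e) (eW g Wg).
by have := B0 _ Sg; lra.
Qed.

Section discrete_space.
Context {R : realType} {d : nat}.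
Local Notation E := 'rV[R]_d.
Local Notation mu := (lebesgue_rV d).
Variables (T : mesh R d) (Omega : set E) (phi : E -> E -> R).
Hypothesis phiP : nodal_basis T phi.
Hypotheses (mO : measurable Omega) (finO : (mu Omega < +oo)%E).
Hypothesis OhE : discrete_domain T Omega = closure Omega.
Local Notation V := (Vpc_c0 T Omega phi).

Lemma Vpc_c0_measurable w : V w -> measurable_fun setT w.
Proof.
move=> [c ->]; apply: measurable_nodal_combination => //.
by rewrite OhE; exact: closed_closure.
Qed.

Lemma Vpc_c0_L2 w : V w -> L2 (w \_ Omega).
Proof.
move=> Vw; have mw := Vpc_c0_measurable Vw; have [c wE] := Vw.
apply: (@bounded_L2 _ _ _ _ (\sum_(z <- nodes T) `|c z|)) => // x.
by rewrite wE; exact: nodal_combination_bounded.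
Qed.

Lemma Vpc_c0_off w x : V w -> ~ closure Omega x -> w x = 0.
Proof.
move=> [c ->] nx; rewrite big1// => z _.
by rewrite patchE OhE memNset// mulr0.
Qed.

Lemma Vpc_c0B v w : V v -> V w -> V (fun x => v x - w x).
Proof.
move=> [c ->] [c' ->]; exists (fun z => c z - c' z); apply/funext => x.
by rewrite -sumrB; apply: eq_bigr => z _; rewrite mulrBl.
Qed.

Lemma Vpc_c0_best_approximation u : L2 (u \_ Omega) ->
  exists2 w, V w & forall w', V w' ->
    sqnorm (fun x => (u \_ Omega) x - (w \_ Omega) x) <=
    sqnorm (fun x => (u \_ Omega) x - (w' \_ Omega) x).
Proof.
move=> hu.
pose s := [seq z <- nodes T | `[< discrete_domain T Omega z >]].
pose F z := (phi z \_ (discrete_domain T Omega)) \_ Omega.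
pose w (c : E -> R) x := \sum_(z <- nodes T | `[< discrete_domain T Omega z >])
  c z * (phi z \_ (discrete_domain T Omega)) x.
have wE c : w c \_ Omega = fun x => \sum_(z <- s) c z * F z x.
  apply/funext => x; rewrite patchE big_filter; case: ifPn => xO.
    by apply: eq_bigr => z _; rewrite /F [in RHS]patchE xO.
  by rewrite big1// => z _; rewrite /F patchE (negPf xO) mulr0.
have us : uniq s by apply: filter_uniq; exact: fset_uniq.
have LF z : z \in s -> L2 (F z).
  move=> zs; have Vz : V (w (fun y => (y == z)%:R)) by eexists.
  have := Vpc_c0_L2 Vz; rewrite wE; congr L2; apply/funext => x.
  rewrite (bigD1_seq z)//= eqxx mul1r big1 ?addr0// => y /negPf ->.
  by rewrite mul0r.
have [c cP] := least_squares us LF hu.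
exists (w c); first by eexists.
move=> _ [c' ->]; by rewrite -/(w c') (wE c) (wE c'); exact: cP.
Qed.

(** Splits f - w into f - g, small by the choice of g, and g - w, where w is the
    nodal interpolant of g. *)
Lemma Vpc_c0_interpolation (f g : E -> R) (L e : R) : L2 (f \_ Omega) ->
  measurable_fun setT g -> 0 <= L ->
  (forall x y, `|g x - g y| <= L * enorm (x - y)) ->
  (\int[mu]_(x in Omega) (((f \_ Omega) x - g x) ^+ 2)%:E <= e%:E)%E ->
  exists2 w, V w & sqnorm (fun x => (f \_ Omega) x - (w \_ Omega) x) <=
    2 * e + 2 * (L * mesh_size T) ^+ 2 * fine (mu Omega).
Proof.
move=> hf mg L0 gL fg.
pose w x := \sum_(z <- nodes T | `[< discrete_domain T Omega z >])
  g z * (phi z \_ (discrete_domain T Omega)) x.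
have Vw : V w by exists g.
exists w => //; have hw := Vpc_c0_L2 Vw; have [mf' _] := hf; have [mw' _] := hw.
rewrite -lee_fin -sqnormE; last exact: L2B.
have mdf : measurable_fun Omega (fun x => (((f \_ Omega) x - g x) ^+ 2)%:E).
  apply/measurable_EFinP/measurable_funX; apply: measurable_funTS.
  exact: measurable_funB.
set h := (L * mesh_size T) ^+ 2.
have finOE : mu Omega \is a fin_num by rewrite ge0_fin_numE.
apply: (@le_trans _ _ (\int[mu]_(x in Omega)
    (2%:E * (((f \_ Omega) x - g x) ^+ 2)%:E + (2 * h)%:E))%E); last first.
  rewrite ge0_integralD//; first last.
  - by move=> x _; rewrite lee_fin mulr_ge0// sqr_ge0.
  - exact: measurable_funeM.
  - by move=> x _; rewrite mule_ge0// lee_fin sqr_ge0.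
  rewrite integral_cst// ge0_integralZl_EFin//; last first.
    by move=> x _; rewrite lee_fin sqr_ge0.
  rewrite (EFinD (2 * e)) leeD//; first by rewrite EFinM lee_pmul2l.
  by rewrite (EFinM (2 * h) (fine _)) (fineK finOE).
rewrite [leRHS]integral_mkcond; apply: ge0_le_integral => //.
- by move=> x _; rewrite lee_fin sqr_ge0.
- by apply/measurable_EFinP/measurable_funX; exact: measurable_funB.
- apply: (proj1 (measurable_restrictT _ mO)).
  by apply: emeasurable_funD => //; exact: measurable_funeM.
move=> x _; rewrite !patchE; case: ifPn => [/set_mem Ox|_]; last first.
  by rewrite subrr expr0n.
have Ohx : discrete_domain T Omega x by rewrite OhE; exact: subset_closure.
have := nodal_interpolation phiP L0 gL Ohx; rewrite -/(w x) => gw.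
have h2 : (g x - w x) ^+ 2 <= h.
  rewrite -real_normK ?num_real// /h ler_sqr ?nnegrE//.
  exact: le_trans gw.
rewrite -EFinM -EFinD lee_fin.
by have := sqr_ge0 (f x - g x - (g x - w x)); lra.
Qed.

End discrete_space.

(** * Error estimates *)

Theorem theorem4p1 (R : realType) (d : nat) (Omega : set 'rV[R]_d) (delta : R)
  (gamma : 'rV[R]_d -> 'rV[R]_d -> R) (tgamma : R -> R)
  (b u : 'rV[R]_d -> R) (Hs : set R) (T : R -> mesh R d)
  (phi : R -> 'rV[R]_d -> 'rV[R]_d -> R) (uh : R -> 'rV[R]_d -> R) :
  let D := full_domain delta Omega in
  let Omega_ h := discrete_domain (T h) Omega in
  let V h := Vpc_c0 (T h) Omega (phi h) in
  let tu h : 'rV[R]_d -> R := u \_ (Omega_ h) in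
  let L2_errors h := [set L2norm (Omega_ h) (u \- w) | w in V h] in
  (0 < d)%N -> lipschitz_convex_domain Omega -> 0 < delta ->
  (forall x y, gamma x y = gamma y x) ->
  kernel_K1 D delta gamma -> kernel_K2 gamma tgamma ->
  (forall r, delta < r -> tgamma r = 0) ->
  square_integrable Omega b -> {within Omega, continuous b} ->
  nonlocal_solution delta Omega gamma b u ->
  mesh_family delta Omega Hs T -> shape_regular Hs T -> quasi_uniform Hs T ->
  (forall h, Hs h -> nodal_basis (T h) (phi h)) ->
  (forall h, Hs h -> discrete_solution Omega (Omega_ h) (V h) gamma b (uh h)) ->
  (forall h, Hs h ->
    (energy_norm D gamma (tu h \- uh h)%R <=
     ereal_inf [set energy_norm D gamma (tu h \- w)%R | w in V h])%E) /\
  exists (C : R) (min_error : R -> \bar R),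
    [/\ forall h, Hs h ->
          L2_errors h (min_error h) /\ lbound (L2_errors h) (min_error h),
        forall h, Hs h ->
          (L2norm (Omega_ h) (u \- uh h)%R <= C%:E * min_error h)%E &
        min_error h @[h --> within Hs 0^'+] --> 0%E].
Proof.
destruct d as [|n]; first by [].
move=> D Omega_ V tu L2_errors _ [neO oO bO cO _] delta0 _ _ [gE g0 mt k1] tg0
  hb _ [hu u0 Lu] [Hs0 _ HT] _ _ phiP uhP.
pose k (z : 'rV[R]_n.+1) := tgamma (enorm z).
have gammaE : gamma = fun x y => k (y - x).
  by apply/funext => x; apply/funext => y; exact: gE.
have k0 z : 0 <= k z by have := g0 0 z; rewrite gammaE /= subr0.
have kN z : k (- z) = k z by rewrite /k -scaleN1r enormZ normrN1 mul1r.
subst gamma; clear gE g0.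
have mO := open_measurable_rV oO.
have mD : measurable D.
  by apply: open_measurable_rV; exact: open_full_domain.
have CD : closure Omega `<=` D by exact: closure_subset_full_domain.
have OD : Omega `<=` D by move=> x Ox; left.
have [r r0 Or] := bounded_coord bO.
have finO := lebesgue_rV_bounded_lty mO Or.
have Onull := convex_boundary_null neO oO bO cO.
have kD x y : Omega x -> ~ D y -> k (y - x) = 0.
  move=> Ox nDy; apply: tg0; rewrite ltNge; apply/negP => yx.
  exact/nDy/(full_domain_near oO delta0 Ox yx).
have OhE h : Hs h -> Omega_ h = closure Omega by move=> /HT[].
have u0' : {ae lebesgue_rV n.+1, forall y, D y -> ~ Omega y -> u y = 0}.
  by apply: filterS u0 => y uy [//|Iy] _; exact: uy.
have mDu : measurable_fun D u by case: hu.
have hu' : L2 (u \_ Omega) by exact: square_integrable_L2 hu.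
have hb' : L2 (b \_ Omega) by exact: square_integrable_L2 hb.
pose err (w : 'rV[R]_n.+1 -> R) x : R := (u \_ Omega) x - (w \_ Omega) x.
have Lerr h w : Hs h -> V h w -> L2 (err w).
  by move=> Hh Vw; apply: L2B => //; apply: (Vpc_c0_L2 (phiP h Hh)) => //; exact: OhE.
have gal h w : Hs h -> V h w -> form k (err (uh h)) (w \_ Omega) = 0.
  move=> Hh Vw; have [Vuh uhE] := uhP h Hh; have OE := OhE h Hh.
  apply: (galerkin_orthogonality k0 mt k1 kN mO mD OD kD Onull mDu u0' hu' hb') => //.
  all: try exact: (Vpc_c0_measurable (phiP h Hh) OE).
  all: try exact: (Vpc_c0_L2 (phiP h Hh) mO finO OE).
  - by move=> x; exact: (Vpc_c0_off OE Vuh).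
  - by move=> x; exact: (Vpc_c0_off OE Vw).
  - by have := uhE w Vw; rewrite -/(Omega_ h) OE.
have errB (w w' : 'rV[R]_n.+1 -> R) x : err w x + ((fun y => w y - w' y) \_ Omega) x = err w' x.
  rewrite /err !patchE; case: ifP => _; first by ring.
  by rewrite !subrr add0r.
have best h w : Hs h -> V h w ->
    form k (err (uh h)) (err (uh h)) <= form k (err w) (err w).
  move=> Hh Vw; have [Vuh _] := uhP h Hh.
  have Vd : V h (fun y => uh h y - w y) by exact: Vpc_c0B.
  have := form_pythagoras k0 mt k1 kN (Lerr _ _ Hh Vuh)
    (Vpc_c0_L2 (phiP h Hh) mO finO (OhE h Hh) Vd) (gal _ _ Hh Vd).
  rewrite (_ : (fun x => _) = err w)//.
  by apply/funext => x; exact: errB.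
have mC : measurable (closure Omega).
  by apply: closed_measurable_rV; exact: closed_closure.
have energyE h w : Hs h -> V h w ->
    energy_norm D (fun x y => k (y - x)) (tu h \- w)%R =
    (Num.sqrt (form k (err w) (err w)))%:E.
  move=> Hh Vw; have OE := OhE h Hh.
  have E : (tu h \- w) \_ Omega = err w.
    apply/funext => x; rewrite /err /tu OE /= !patchE.
    have [Ox|nOx] := pselect (Omega x); last by rewrite (memNset nOx) subrr.
    by rewrite (mem_set Ox) /= patchE (mem_set (subset_closure Ox)).
  rewrite -E; apply: (energy_norm_restrict k0 mt k1 kN mO mD OD kD Onull).
  - apply: measurable_funB; last exact: (Vpc_c0_measurable (phiP h Hh) OE).
    rewrite /tu OE; apply: (proj1 (measurable_restrictT u mC)).
    exact: measurable_funS mDu.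
  - move=> x nCx; rewrite /= /tu OE patchE memNset// (Vpc_c0_off OE Vw nCx).
    by rewrite subr0.
  - by rewrite E; exact: (Lerr _ _ Hh Vw).
split.
  move=> h Hh; have [Vuh _] := uhP h Hh; rewrite energyE//.
  apply: le_ereal_inf_tmp => _ [w Vw <-]; rewrite energyE// lee_fin ler_wsqrtr//.
  exact: best.
have L2E h w : Hs h -> V h w ->
    L2norm (Omega_ h) (u \- w)%R = (Num.sqrt (sqnorm (err w)))%:E.
  move=> Hh Vw; have OE := OhE h Hh.
  have E : (u \- w) \_ Omega = err w.
    by apply/funext => x; rewrite /err /= !patchE; case: ifP => _; rewrite ?subrr.
  rewrite OE -E; apply: (L2norm_closure mO mD Onull _ CD).
  - apply: measurable_funB => //; apply: measurable_funTS.
    exact: (Vpc_c0_measurable (phiP h Hh) OE).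
  - by rewrite E; exact: (Lerr _ _ Hh Vw).
have [c c0 cP] := nonlocal_poincare k0 mt k1 kN r0.
(* Coercivity, then optimality in energy, then boundedness of the form. *)
have quasi h w : Hs h -> V h w ->
    sqnorm (err (uh h)) <= 4 / c * sqnorm (err w).
  move=> Hh Vw; have [Vuh _] := uhP h Hh.
  rewrite mulrAC ler_pdivlMr// mulrC.
  apply: le_trans (form_le k0 mt k1 kN (Lerr _ _ Hh Vw)).
  apply: le_trans (best _ _ Hh Vw); apply: cP; first exact: (Lerr _ _ Hh Vuh).
  move=> x ex i; apply: Or; apply: contrapT => nOx; move: ex.
  by rewrite /err !patchE memNset// subrr eqxx.
have minE h : Hs h -> exists w, [/\ V h w,
    forall w', V h w' -> sqnorm (err w) <= sqnorm (err w') &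
    ereal_inf (L2_errors h) = (Num.sqrt (sqnorm (err w)))%:E].
  move=> Hh; have [w Vw wP] := Vpc_c0_best_approximation (phiP h Hh) mO finO (OhE h Hh) hu'.
  exists w; split=> //; apply/eqP; rewrite eq_le; apply/andP; split.
    by apply: ereal_inf_lbound; exists w => //; exact: L2E.
  apply: le_ereal_inf_tmp => _ [w' Vw' <-]; rewrite L2E// lee_fin ler_wsqrtr//.
  exact: wP.
exists (Num.sqrt (4 / c)), (fun h => ereal_inf (L2_errors h)); split.
- move=> h Hh; have [w [Vw _ wE]] := minE h Hh; split.
    by rewrite wE; exists w => //; exact: L2E.
  exact: ereal_inf_lbound.
- move=> h Hh; have [w [Vw _ ->]] := minE h Hh; have [Vuh _] := uhP h Hh.
  rewrite L2E// -EFinM lee_fin -sqrtrM; last by rewrite divr_ge0// ltW.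
  by apply: ler_wsqrtr; exact: quasi.
apply/fine_cvgP; split.
  rewrite near_withinE; apply: nearW => h Hh.
  by have [w [_ _ ->]] := minE h Hh.
apply/cvgr0Pnorm_lt => e e0.
(* Half of e^2 bounds the squared error: a quarter for approximating u by a
   Lipschitz g, and a quarter for interpolating g on a mesh of size below eta. *)
have e8 : 0 < e ^+ 2 / 8 by rewrite divr_gt0// exprn_gt0.
have [mu' iu'] := hu'.
have iu'O : (lebesgue_rV n.+1).-integrable Omega (fun x => ((u \_ Omega) x ^+ 2)%:E).
  exact: integrableS iu'.
have [_ /(_ _ e8)[g [mg [L L0 gL] gu]]] := lipschitz_dense mO finO mu' iu'O.
pose m := fine (lebesgue_rV n.+1 Omega).
have m0 : 0 <= m by exact: fine_ge0.
pose A := 2 * L ^+ 2 * m + 1.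
have A0 : 0 < A by rewrite ltr_wpDl// !mulr_ge0// sqr_ge0.
pose eta := Num.min 1 (e ^+ 2 / 4 / A).
have eta0 : 0 < eta by rewrite lt_min ltr01 !divr_gt0// exprn_gt0.
rewrite near_withinE; near=> h => Hh.
have h0 : 0 < h by exact: Hs0.
have heta : h < eta by near: h; exact: nbhs_right_lt.
have [w [Vw wP /= ->]] := minE h Hh.
rewrite /= ger0_norm ?sqrtr_ge0//.
have [w' Vw' w'e] := Vpc_c0_interpolation (phiP h Hh) mO finO (OhE h Hh) hu' mg L0 gL gu.
have [_ _ meshE] := HT h Hh; rewrite meshE -/m in w'e.
have hA : h ^+ 2 * A <= e ^+ 2 / 4.
  rewrite -ler_pdivlMr//; apply: le_trans (_ : h <= _).
    rewrite expr2 ger_pMr// ltW// (lt_le_trans heta)// ge_min lexx//.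
  by rewrite ltW// (lt_le_trans heta)// ge_min lexx orbT.
have : sqnorm (err w) < e ^+ 2.
  apply: le_lt_trans (wP _ Vw') _; apply: le_lt_trans w'e _.
  have : 0 < e ^+ 2 by rewrite exprn_gt0.
  have := sqr_ge0 h; move: hA; rewrite /A; lra.
move=> we; rewrite -(ger0_norm (ltW e0)) -sqrtr_sqr ltr_sqrt// exprn_gt0//.
Unshelve. all: by end_near.
Qed.
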